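(* Let $k$ be a positive even integer and let $f:\mathcal H\to\mathbb C$ be a holomorphic function on the upper half-plane with a Fourier expansion $f(z)=\sum_{n=1}^\infty a_n e^{2\pi i n z}$ such that $f|H_{13}=\pm f$ (for one of the two signs) and, for every prime $p$, $f|T_p=p^{1-k/2}a_p f$, where $H_{13}=\begin{pmatrix}0&-1\\13&0\end{pmatrix}$ and $T_p$ is the level $13$ Hecke operator with trivial character. Put $$\gamma=\begin{pmatrix}3&1\\-13&-4\end{pmatrix},\quad \varepsilon_1=\begin{pmatrix}\sqrt{13}&\frac{14}{3\sqrt{13}}\\-3\sqrt{13}&-\sqrt{13}\end{pmatrix},\quad \varepsilon_2=\begin{pmatrix}-\sqrt{13}&\frac{-4}{\sqrt{13}}\\ \frac{7\sqrt{13}}{2}&\sqrt{13}\end{pmatrix}.$$ Then $$f\big|\,(1-\gamma)(1-\varepsilon)=0$$ for every $\varepsilon$ in the group generated by $\varepsilon_1$ and $\varepsilon_2$.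
   Context: $\mathcal H=\{x+iy\in\mathbb C: y>0\}$. For $M=\begin{pmatrix}a&b\\c&d\end{pmatrix}\in GL_2(\mathbb R)$ with $\det M>0$, the weight $k$ action is $(f|M)(z)=(\det M)^{k/2}(cz+d)^{-k}f\left(\frac{az+b}{cz+d}\right)$. It is a right action, so $f|(XY)=(f|X)|Y$, and it is extended linearly to the group ring $\mathbb C[GL_2(\mathbb R)^+]$; $1$ denotes the identity of the group ring. Since $k$ is even, nonzero scalar matrices act trivially. The level $13$ Hecke operators with trivial character are the group ring elements $$T_p=\chi_0(p)\begin{pmatrix}p&0\\0&1\end{pmatrix}+\sum_{a=0}^{p-1}\begin{pmatrix}1&a\\0&p\end{pmatrix}$$ for $p$ prime, where $\chi_0(p)=1$ if $p\ne 13$ and $\chi_0(13)=0$. With this normalization, the condition $f|T_p=p^{1-k/2}a_pf$ for all primes $p$ is equivalent to $a_{pn}+\chi_0(p)p^{k-1}a_{n/p}=a_pa_n$ for all $n\ge1$ and all primes $p$ (with $a_{n/p}=0$ if $p\nmid n$). *)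

(* Defs.v *)
(* MathComp / MathComp-Analysis.  The real numbers are an arbitrary
   [R : realType]; the complex numbers are [R[i]]. *)
From HB Require Import structures.
From mathcomp Require Import all_boot all_order all_algebra.
From mathcomp Require Import finmap complex.
From mathcomp Require Import boolp classical_sets reals topology normedtype.
From mathcomp Require Import sequences derive exp trigo.

Set Implicit Arguments.
Unset Strict Implicit.
Unset Printing Implicit Defensive.

Import Order.TTheory GRing.Theory Num.Theory.
Import numFieldNormedType.Exports.

Local Open Scope classical_set_scope.
Local Open Scope ring_scope.
Local Open Scope complex_scope.

(* The group ring K[G]: finitely supported functions G -> K, with the
   convolution product. *)
Definition groupRing (K : nzRingType) (G : groupType) :=
  {fsfun G -> K with 0}.

Section GroupRing.
Variables (K : nzRingType) (G : groupType).
Local Notation KG := (groupRing K G).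
Implicit Types (x y z : KG) (g h : G) (c : K).

HB.instance Definition _ := Choice.on KG.

Definition gr_zero : KG := [fsfun with 0].
Definition gr_add x y : KG :=
  [fsfun g in (finsupp x `|` finsupp y)%fset => x g + y g].
Definition gr_opp x : KG := [fsfun g in finsupp x => - x g].
Definition gr_scale c x : KG := [fsfun g in finsupp x => c * x g].

(* The group element g, viewed in K[G]. *)
Definition gr_elt g : KG := [fsfun h in [fset g]%fset => 1].

Definition gr_mul x y : KG :=
  [fsfun g in [fset (a * b)%g | a in finsupp x, b in finsupp y]%fset =>
     \sum_(a <- finsupp x) x a * y (a^-1 * g)%g].

Lemma gr_zeroE g : gr_zero g = 0.
Proof. by rewrite fsfunE. Qed.

Lemma gr_addE x y g : gr_add x y g = x g + y g.
Proof.
rewrite fsfunE in_fsetU; case: ifPn => //; rewrite negb_or => /andP[xg yg].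
by rewrite !fsfun_dflt // addr0.
Qed.

Lemma gr_oppE x g : gr_opp x g = - x g.
Proof. by rewrite fsfunE; case: finsuppP => //; rewrite oppr0. Qed.

Lemma gr_scaleE c x g : gr_scale c x g = c * x g.
Proof. by rewrite fsfunE; case: finsuppP => //; rewrite mulr0. Qed.

Lemma gr_eltE g h : gr_elt g h = (h == g)%:R.
Proof. by rewrite fsfunE in_fset1; case: eqP. Qed.

Lemma gr_mulE x y g :
  gr_mul x y g = \sum_(a <- finsupp x) x a * y (a^-1 * g)%g.
Proof.
rewrite fsfunE; case: ifPn => // /negP gxy; rewrite big_seq big1 // => a ax.
have [yg|/fsfun_dflt ->] := boolP ((a^-1 * g)%g \in finsupp y);
  last by rewrite mulr0.
by case: gxy; apply/imfset2P; exists a => //; exists (a^-1 * g)%g => //;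
  rewrite mulVKg.
Qed.

Lemma gr_sumW (S : {fset G}) x (F : G -> K) :
    (finsupp x `<=` S)%fset ->
  \sum_(a <- finsupp x) x a * F a = \sum_(a <- S) x a * F a.
Proof.
by move=> xS; apply: big_fset_incl => // a _ ax; rewrite fsfun_dflt // mul0r.
Qed.

Lemma gr_mulWE (S : {fset G}) x y g : (finsupp x `<=` S)%fset ->
  gr_mul x y g = \sum_(a <- S) x a * y (a^-1 * g)%g.
Proof. by move=> xS; rewrite gr_mulE (gr_sumW _ xS). Qed.

Fact gr_addA : associative gr_add.
Proof. by move=> x y z; apply/fsfunP => g; rewrite !gr_addE addrA. Qed.
Fact gr_addC : commutative gr_add.
Proof. by move=> x y; apply/fsfunP => g; rewrite !gr_addE addrC. Qed.
Fact gr_add0 : left_id gr_zero gr_add.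
Proof. by move=> x; apply/fsfunP => g; rewrite gr_addE gr_zeroE add0r. Qed.
Fact gr_addN : left_inverse gr_zero gr_opp gr_add.
Proof.
by move=> x; apply/fsfunP => g; rewrite gr_addE gr_oppE gr_zeroE addNr.
Qed.

HB.instance Definition _ :=
  GRing.isZmodule.Build KG gr_addA gr_addC gr_add0 gr_addN.

Fact gr_mulA : associative gr_mul.
Proof.
move=> x y z; apply/fsfunP => g.
set S : {fset G} := [fset (a * b)%g | a in finsupp x, b in finsupp y]%fset.
have xyS : (finsupp (gr_mul x y) `<=` S)%fset.
  apply/fsubsetP => h; rewrite mem_finsupp; apply: contraNT => hS.
  by rewrite fsfunE (negPf hS).
rewrite (gr_mulWE _ _ xyS) gr_mulE.
under [RHS]eq_bigr do rewrite gr_mulE mulr_suml.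
rewrite exchange_big /= big_seq [RHS]big_seq; apply: eq_bigr => a ax.
under [RHS]eq_bigr do rewrite -mulrA.
rewrite -mulr_sumr; congr (_ * _); rewrite gr_mulE.
pose aY : {fset G} := [fset (a * b)%g | b in finsupp y]%fset.
have aYS : (aY `<=` S)%fset.
  apply/fsubsetP => _ /imfsetP[b /= yb ->].
  by apply/imfset2P; exists a => //; exists b.
rewrite -(big_fset_incl _ aYS) /=; last first.
  move=> h _ haY; rewrite fsfun_dflt ?mul0r //; apply: contra haY => hy.
  by apply/imfsetP; exists (a^-1 * h)%g => //; rewrite mulVKg.
rewrite big_imfset /=; last by move=> b c _ _ /mulgI.
by apply: eq_bigr => b _; rewrite mulKg invgM mulgA.
Qed.

Fact gr_mul1 : left_id (gr_elt 1%g) gr_mul.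
Proof.
move=> x; apply/fsfunP => g; rewrite (@gr_mulWE [fset 1%g]%fset).
  by rewrite big_seq_fset1 gr_eltE eqxx mul1r invg1 mul1g.
by rewrite finsupp_sub.
Qed.

Fact gr_1mul : right_id (gr_elt 1%g) gr_mul.
Proof.
move=> x; apply/fsfunP => g.
rewrite (@gr_mulWE (g |` finsupp x)%fset) ?fsubsetUr //.
rewrite (big_fsetD1 g) ?fset1U1 //= gr_eltE mulVg eqxx mulr1 big_seq big1.
  by rewrite addr0.
move=> a; rewrite in_fsetD1 => /andP[/negPf ag _].
by rewrite gr_eltE -(inj_eq (mulgI a)) mulVKg mulg1 eq_sym ag mulr0.
Qed.

Fact gr_mulDl : left_distributive gr_mul gr_add.
Proof.
move=> x y z; apply/fsfunP => g; rewrite gr_addE.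
set S := (finsupp x `|` finsupp y)%fset.
rewrite !(@gr_mulWE S) ?fsubsetUl ?fsubsetUr ?finsupp_sub //.
by rewrite -big_split; apply: eq_bigr => a _; rewrite gr_addE mulrDl.
Qed.

Fact gr_mulDr : right_distributive gr_mul gr_add.
Proof.
move=> x y z; apply/fsfunP => g; rewrite gr_addE !gr_mulE -big_split.
by apply: eq_bigr => a _; rewrite gr_addE mulrDr.
Qed.

Fact gr_one_neq0 : gr_elt 1%g != 0.
Proof.
apply/eqP => /fsfunP/(_ 1%g); rewrite gr_eltE gr_zeroE eqxx => /eqP.
by rewrite oner_eq0.
Qed.

HB.instance Definition _ := GRing.Zmodule_isNzRing.Build KG
  gr_mulA gr_mul1 gr_1mul gr_mulDl gr_mulDr gr_one_neq0.

Fact gr_scaleA c d x : gr_scale c (gr_scale d x) = gr_scale (c * d) x.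
Proof. by apply/fsfunP => g; rewrite !gr_scaleE mulrA. Qed.
Fact gr_scale1 : left_id 1 gr_scale.
Proof. by move=> x; apply/fsfunP => g; rewrite gr_scaleE mul1r. Qed.
Fact gr_scaleDr : right_distributive gr_scale +%R.
Proof.
by move=> c x y; apply/fsfunP => g; rewrite gr_addE !gr_scaleE gr_addE mulrDr.
Qed.
Fact gr_scaleDl x : {morph gr_scale^~ x : c d / c + d}.
Proof.
by move=> c d; apply/fsfunP => g; rewrite gr_addE !gr_scaleE mulrDl.
Qed.

HB.instance Definition _ := GRing.Zmodule_isLmodule.Build K KG
  gr_scaleA gr_scale1 gr_scaleDr gr_scaleDl.

End GroupRing.

Section Subgroup.
Variable G : groupType.

Definition is_subgroup (A : set G) :=
  A 1%g /\ forall x y, A x -> A y -> A (x / y)%g.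

Definition generated (S : set G) : set G := smallest is_subgroup S.

End Subgroup.

(* GL_2(R)^+ *)
Definition GL2p (R : realType) := {M : 'M[R]_2 | 0 < \det M}.

Section GL2p.
Variable R : realType.
Implicit Types M N : GL2p R.

HB.instance Definition _ := Choice.on (GL2p R).
HB.instance Definition _ := SubType.on (GL2p R).

Fact GL2p_one_subproof : 0 < \det (1%:M : 'M[R]_2).
Proof. by rewrite det1. Qed.
Fact GL2p_mul_subproof M N : 0 < \det (val M *m val N).
Proof. by rewrite det_mulmx mulr_gt0 ?(valP M) ?(valP N). Qed.
Fact GL2p_inv_subproof M : 0 < \det (invmx (val M)).
Proof. by rewrite det_inv invr_gt0 (valP M). Qed.

Definition GL2p_one : GL2p R := Sub 1%:M GL2p_one_subproof.
Definition GL2p_mul M N : GL2p R := Sub (val M *m val N) (GL2p_mul_subproof M N).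
Definition GL2p_inv M : GL2p R := Sub (invmx (val M)) (GL2p_inv_subproof M).

Fact GL2p_unit M : val M \in unitmx.
Proof. by rewrite unitmxE unitfE gt_eqF ?(valP M). Qed.

Fact GL2p_mulA : associative GL2p_mul.
Proof. by move=> M N P; apply: val_inj; rewrite /= mulmxA. Qed.
Fact GL2p_mul1g : left_id GL2p_one GL2p_mul.
Proof. by move=> M; apply: val_inj; rewrite /= mul1mx. Qed.
Fact GL2p_mulg1 : right_id GL2p_one GL2p_mul.
Proof. by move=> M; apply: val_inj; rewrite /= mulmx1. Qed.
Fact GL2p_mulVg : left_inverse GL2p_one GL2p_inv GL2p_mul.
Proof. by move=> M; apply: val_inj; rewrite /= mulVmx ?GL2p_unit. Qed.
Fact GL2p_mulgV : right_inverse GL2p_one GL2p_inv GL2p_mul.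
Proof. by move=> M; apply: val_inj; rewrite /= mulmxV ?GL2p_unit. Qed.

HB.instance Definition _ := isGroup.Build (GL2p R)
  GL2p_mulA GL2p_mul1g GL2p_mulg1 GL2p_mulVg GL2p_mulgV.

Definition mx2 (a b c d : R) : 'M[R]_2 :=
  \matrix_(i, j) if i == 0 then (if j == 0 then a else b)
                 else (if j == 0 then c else d).

Lemma det_mx2 a b c d : \det (mx2 a b c d) = a * d - b * c.
Proof.
rewrite (expand_det_row _ 0) big_ord_recl big_ord1 /cofactor !det_mx11 !mxE /=.
by rewrite expr0 mul1r expr1 mulN1r mulrN.
Qed.

(* (a b; c d) as an element of GL_2(R)^+; junk value 1 when ad - bc <= 0. *)
Definition gl2 (a b c d : R) : GL2p R := insubd (1%g : GL2p R) (mx2 a b c d).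

Lemma val_gl2 a b c d : 0 < a * d - b * c -> val (gl2 a b c d) = mx2 a b c d.
Proof. by move=> D0; rewrite val_insubd det_mx2 D0. Qed.

End GL2p.

Section Slash.
Variable R : realType.
Local Notation C := R[i].
Implicit Types (f : C -> C) (z : C).

Definition uhp : set C := [set z | 0 < complex.Im z].

(* Functions on the upper half-plane are represented by functions on C whose
   values off [uhp] are irrelevant.  Complex differentiability is
   differentiability in the direction 1 over the scalar field C. *)
Definition holomorphic_on (U : set C) f :=
  forall z, U z -> derivable (f : C^o -> C^o) (z : C^o) (1 : C^o).

Definition cexp z : C :=
  (expR (complex.Re z))%:C * (cos (complex.Im z) +i* sin (complex.Im z)).

(* The weight is even, so that (det M)^{k/2} is a natural power. *)
Definition slash (k : nat) f (M : GL2p R) z : C :=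
  let: a := (val M 0 0)%:C in let: b := (val M 0 1)%:C in
  let: c := (val M 1 0)%:C in let: d := (val M 1 1)%:C in
  ((\det (val M))%:C ^+ k./2) * (c * z + d) ^- k * f ((a * z + b) / (c * z + d)).

Definition slash_gr (k : nat) f (xi : groupRing C (GL2p R)) z : C :=
  \sum_(M <- finsupp xi) xi M * slash k f M z.

Definition hecke13 (p : nat) : groupRing C (GL2p R) :=
  (p != 13)%:R *: gr_elt C (gl2 p%:R 0 0 1)
  + \sum_(0 <= a < p) gr_elt C (gl2 1 a%:R 0 p%:R).

(* f(z) = sum_{n >= 1} a_n e^{2 pi i n z} on the upper half-plane; the value
   a 0 plays no role. *)
Definition fourier_expansion f (a : nat -> C) :=
  forall z, uhp z ->
    (\sum_(1 <= n < N) a n * cexp (2 * pi%:C * 'i%C * n%:R * z) : C^o)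
      @[N --> \oo] --> (f z : C^o).

End Slash.

(* Main.v *)
Require Import Defs.
From HB Require Import structures.
From mathcomp Require Import all_boot all_order all_algebra.
From mathcomp Require Import finmap complex.
From mathcomp Require Import boolp classical_sets reals topology normedtype.
From mathcomp Require Import sequences derive realfun exp trigo.
From mathcomp Require Import ring lra zify.

Set Implicit Arguments.
Unset Strict Implicit.
Unset Printing Implicit Defensive.

Import Order.TTheory GRing.Theory Num.Theory.
Import numFieldNormedType.Exports.

Local Open Scope classical_set_scope.
Local Open Scope ring_scope.
Local Open Scope complex_scope.

(** Write [sigma] for the sign of [f] under [H = H_13] and put
    [u = f|(1 - gamma^-1)].  Comparing [T_2], [T_3] and [T_2^2] with their
    conjugates by [H] shows that [f] is fixed by [delta = (2 -1; -13 7)] and that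
    [u|eta = sigma u], [u|theta = sigma u], where [eta] and [theta] are the
    conjugates of [eps1] and [eps2] by [gamma].  For [sigma = 1] this is the claim.

    For [sigma = -1] the relations have the wrong sign, and [u = 0] has to be
    proved.  The matrix [e2 = delta (1 1; 0 1) gamma^-1] has order 2 in PGL_2 and
    [f|e2 = f|gamma^-1], so [u|e2 = -u], and [u] is fixed by [e2 theta] and
    [eta theta].  These are hyperbolic with the same axis, the one of
    [q = 52 z^2 + 26 z + 3], and have multiplicatively independent multipliers,
    hence generate a nondiscrete group.  After moving the axis to the imaginary
    axis, [z^(k/2) u] is invariant under scalings arbitrarily close to 1; its
    derivative vanishes, and therefore [u = c q^(-k/2)].  Finally gamma has
    order 3 in PGL_2, so [u + u|gamma + u|gamma^-1 = 0], which forces [c = 0]. *)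

(** * The weight k slash action on functions on the upper half-plane *)

Section SlashAction.
Variable R : realType.
Local Notation C := R[i].
Implicit Types (f g : C -> C) (z : C) (M N : GL2p R).

Lemma mobius_den_neq0 (a b c d : R) z :
  0 < a * d - b * c -> uhp z -> c%:C * z + d%:C != 0.
Proof.
case: z => x y; rewrite /uhp /= => D0 y0; apply/eqP => /eqP.
rewrite eq_complex /= !mul0r !addr0 subr0 => /andP[/eqP h1].
rewrite mulf_eq0 (gt_eqF y0) orbF => /eqP c0.
by move: h1 D0; rewrite c0 mul0r add0r mulr0 subr0 => ->; rewrite mulr0 ltxx.
Qed.

(** For the image point [w], |cz + d|^2 Im w = (ad - bc) Im z. The identity is read off from the
    coordinates of [w * (c z + d) = a z + b]. *)
Lemma mobius_uhp (a b c d : R) z : 0 < a * d - b * c -> uhp z ->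
  uhp ((a%:C * z + b%:C) / (c%:C * z + d%:C)).
Proof.
move=> D0 z0; have n0 := mobius_den_neq0 D0 z0.
have : ((a%:C * z + b%:C) / (c%:C * z + d%:C)) * (c%:C * z + d%:C) =
  a%:C * z + b%:C by rewrite divfK.
move: (_ / _) => w; case: z z0 n0 w => x y /= y0 n0 [p q] /= [h1 h2].
rewrite /uhp /=.
rewrite -(@pmulr_rgt0 R ((c * x + d) ^+ 2 + (c * y) ^+ 2)); last first.
  rewrite lt_neqAle addr_ge0 ?sqr_ge0 // andbT eq_sym paddr_eq0 ?sqr_ge0 //.
  rewrite !sqrf_eq0; apply: contra n0 => /andP[/eqP e1 /eqP e2].
  by rewrite eq_complex /= !mul0r !addr0 subr0 e1 e2 eqxx.
suff e : ((c * x + d) ^+ 2 + (c * y) ^+ 2) * q = (a * d - b * c) * y.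
  by rewrite e mulr_gt0.
rewrite (_ : _ * q =
  (c * x + d) * (p * (c * y + 0 * x + 0) + q * (c * x - 0 * y + d)) -
  c * y * (p * (c * x - 0 * y + d) - q * (c * y + 0 * x + 0))); last by ring.
by rewrite h1 h2; ring.
Qed.

Variable k : nat.
Hypothesis k_even : ~~ odd k.
Local Notation m := (k./2).

Lemma mx2E (a b c d : R) : (mx2 a b c d 0 0 = a) * (mx2 a b c d 0 1 = b) *
  (mx2 a b c d 1 0 = c) * (mx2 a b c d 1 1 = d).
Proof. by rewrite !mxE. Qed.

Lemma GL2pP M : exists a b c d : R, 0 < a * d - b * c /\ val M = mx2 a b c d.
Proof.
exists (val M 0 0), (val M 0 1), (val M 1 0), (val M 1 1).
suff e : val M = mx2 (val M 0 0) (val M 0 1) (val M 1 0) (val M 1 1).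
  by split=> //; rewrite -det_mx2 -e (valP M).
by apply/matrixP => i j; rewrite mxE; case: i => [[|[|//]] ?]; case: j =>
  [[|[|//]] ?] /=;
  congr (val M _ _); apply: val_inj.
Qed.

Lemma slash_mx2 f M a b c d z : val M = mx2 a b c d ->
  slash k f M z = (a * d - b * c)%:C ^+ m * (c%:C * z + d%:C) ^- k *
                  f ((a%:C * z + b%:C) / (c%:C * z + d%:C)).
Proof. by move=> e; rewrite /slash e det_mx2 !mx2E. Qed.

Lemma mulmx_mx2 (a b c d a' b' c' d' : R) :
  mx2 a b c d *m mx2 a' b' c' d' =
  mx2 (a * a' + b * c') (a * b' + b * d') (c * a' + d * c') (c * b' + d * d').
Proof.
by apply/matrixP => i j; rewrite !mxE big_ord_recl big_ord1 !mxE /=;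
  case: (i == 0); case: (j == 0).
Qed.

(** Determinants are multiplicative, [n3] is the cocycle identity of the automorphy factor cz + d,
    and [n4] says that Moebius maps compose like matrices. *)
Lemma slashM f M N z : uhp z ->
  slash k (slash k f M) N z = slash k f (M * N)%g z.
Proof.
move=> z0; case: (GL2pP M) => a [b [c [d [D1 eM]]]].
case: (GL2pP N) => a' [b' [c' [d' [D2 eN]]]].
have eMN : val (M * N)%g = mx2 (a * a' + b * c') (a * b' + b * d') (c * a' + d *
  c') (c * b' + d * d').
  by rewrite /= eM eN mulmx_mx2.
rewrite (slash_mx2 _ _ eN) (slash_mx2 _ _ eM) (slash_mx2 _ _ eMN).
have n1 := mobius_den_neq0 D2 z0.
have n2 := mobius_den_neq0 D1 (mobius_uhp D2 z0).
have -> : ((a * a' + b * c') * (c * b' + d * d') -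
  (a * b' + b * d') * (c * a' + d * c')) = (a * d - b * c) * (a' * d' - b' * c').
  by ring.
move: n1 n2; rewrite !(rmorphD, rmorphM) /=.
set A := a%:C; set B := b%:C; set E := c%:C; set D := d%:C.
set A' := a'%:C; set B' := b'%:C; set E' := c'%:C; set D' := d'%:C => n1 n2.
have n3 : (E * A' + D * E') * z + (E * B' + D * D') =
   (E' * z + D') * (E * ((A' * z + B') / (E' * z + D')) + D) by field.
have n4 : ((A * A' + B * E') * z + (A * B' + B * D')) / ((E * A' + D * E') * z +
  (E * B' + D * D')) =
   (A * ((A' * z + B') / (E' * z + D')) + B) / (E * ((A' * z + B') / (E' * z +
     D')) + D).
  rewrite n3; field; rewrite n1 /=; move: n2; apply: contra => /eqP h.
  have -> : E * ((A' * z + B') / (E' * z + D')) + D = (E * (A' * z + B') + D * (E'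
    * z + D')) / (E' * z + D') by field.
  by rewrite h mul0r.
rewrite n4 n3 !exprMn invfM; ring.
Qed.

(** The determinant contributes t^k and the automorphy factor t^-k, where evenness of [k] makes
    twice [k./2] equal to [k]. Matrices with square roots or denominators can thus be replaced by
    integral multiples. *)
Lemma slash_scale f M N (t : R) z : t != 0 -> val M = t *: val N ->
  slash k f M z = slash k f N z.
Proof.
move=> t0 e; rewrite /slash e !mxE detZ !(rmorphM, rmorphXn) /=.
set T := t%:C; have T0 : T != 0 by rewrite fmorph_eq0.
have Tk : T ^+ k != 0 by rewrite expf_neq0.
have Tm : (T ^+ 2) ^+ m = T ^+ k.
  by rewrite -exprM mul2n halfK (negPf k_even) subn0.
rewrite -!(mulrA T) -!(mulrDr T) -mulf_div divff // mul1r.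
rewrite exprMn (exprMn m T (\det _)%:C) mulrA -exprMn -expr2 Tm.
by rewrite [(T * _) ^+ k]exprMn -mulf_div divff // mul1r.
Qed.

Lemma gl2M (a b c d a' b' c' d' : R) :
  0 < a * d - b * c -> 0 < a' * d' - b' * c' ->
  (gl2 a b c d * gl2 a' b' c' d')%g =
  gl2 (a * a' + b * c') (a * b' + b * d') (c * a' + d * c') (c * b' + d * d').
Proof.
move=> D1 D2; apply: val_inj; rewrite /= !val_gl2 ?mulmx_mx2 //.
have -> : ((a * a' + b * c') * (c * b' + d * d') -
  (a * b' + b * d') * (c * a' + d * c')) = (a * d - b * c) * (a' * d' - b' * c').
  by ring.
exact: mulr_gt0.
Qed.

Lemma slash_gl2M f (a b c d a' b' c' d' : R) z : uhp z ->
  0 < a * d - b * c -> 0 < a' * d' - b' * c' ->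
  slash k (slash k f (gl2 a b c d)) (gl2 a' b' c' d') z =
  slash k f (gl2 (a * a' + b * c') (a * b' + b * d') (c * a' + d * c') (c * b' + d
    * d')) z.
Proof. by move=> z0 D1 D2; rewrite slashM // gl2M. Qed.

Lemma slash_gl2Z f (t a b c d : R) z : 0 < a * d - b * c -> t != 0 ->
  slash k f (gl2 (t * a) (t * b) (t * c) (t * d)) z = slash k f (gl2 a b c d) z.
Proof.
move=> D0 t0; apply: (slash_scale _ _ t0); rewrite !val_gl2 //.
  by apply/matrixP => i j; rewrite !mxE; case: (i == 0); case: (j == 0).
have -> : t * a * (t * d) - t * b * (t * c) = t ^+ 2 * (a * d - b * c) by ring.
by rewrite mulr_gt0 // lt_neqAle sqr_ge0 eq_sym expf_neq0.
Qed.

Lemma uhp_slash f g M z : (forall z, uhp z -> f z = g z) -> uhp z ->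
  slash k f M z = slash k g M z.
Proof.
move=> fg z0; case: (GL2pP M) => a [b [c [d [D1 eM]]]].
by rewrite !(slash_mx2 _ _ eM) fg //; apply: mobius_uhp.
Qed.

Lemma slash1 f z : slash k f 1%g z = f z.
Proof.
rewrite /slash /= det1 !mxE /= !(rmorph0, rmorph1) mul0r !add0r addr0 mul1r.
by rewrite !expr1n invr1 !mul1r mulr1.
Qed.

End SlashAction.

(** * Linear extension of the action to the group ring *)

Section GroupRingAction.
Variable R : realType.
Local Notation C := R[i].
Variables (k : nat) (f : C -> C).
Implicit Types (xi eta : groupRing C (GL2p R)) (g h : GL2p R).

Lemma slash_gr0 z : slash_gr k f 0 z = 0.
Proof. by rewrite /slash_gr big1 // => g _; rewrite [(0 : groupRing _ _)
  g]gr_zeroE mul0r. Qed.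

Lemma slash_grD xi eta z :
  slash_gr k f (xi + eta) z = slash_gr k f xi z + slash_gr k f eta z.
Proof.
rewrite /slash_gr.
set S := (finsupp xi `|` finsupp eta)%fset.
rewrite !(@gr_sumW _ _ S _ (fun M => slash k f M z)) ?fsubsetUl ?fsubsetUr
  ?finsupp_sub //.
by rewrite -big_split; apply: eq_bigr => g _; rewrite [(xi + eta) g]gr_addE mulrDl.
Qed.

Lemma slash_grZ (c : C) xi z : slash_gr k f (c *: xi) z = c * slash_gr k f xi z.
Proof.
rewrite /slash_gr mulr_sumr (@gr_sumW _ _ (finsupp xi) _ (fun M => slash k f M z)).
  apply: eq_bigr => g _; rewrite [(c *: xi) g]gr_scaleE; apply/esym/mulrA.
by rewrite finsupp_sub.
Qed.

Lemma slash_gr_elt g z : slash_gr k f (gr_elt C g) z = slash k f g z.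
Proof.
rewrite /slash_gr (@gr_sumW _ _ [fset g]%fset _ (fun M => slash k f M z)).
  by rewrite big_seq_fset1 gr_eltE eqxx mul1r.
by rewrite finsupp_sub.
Qed.

Lemma slash_grB xi eta z :
  slash_gr k f (xi - eta) z = slash_gr k f xi z - slash_gr k f eta z.
Proof. by rewrite -scaleN1r slash_grD slash_grZ mulN1r. Qed.

Lemma slash_gr_sum (I : Type) (r : seq I) (F : I -> groupRing C (GL2p R)) z :
  slash_gr k f (\sum_(i <- r) F i) z = \sum_(i <- r) slash_gr k f (F i) z.
Proof.
by apply: (big_morph (slash_gr k f ^~ z)) => [x y|]; rewrite ?slash_grD ?slash_gr0.
Qed.

Lemma gr_eltM g h : gr_elt C g * gr_elt C h = gr_elt C (g * h)%g.
Proof.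
apply/fsfunP => x; rewrite [LHS](@gr_mulWE _ _ [fset g]%fset).
  rewrite big_seq_fset1 !gr_eltE eqxx mul1r; congr (_%:R).
  by rewrite -(inj_eq (mulgI g)) mulVKg.
by rewrite finsupp_sub.
Qed.

(** Turns the vanishing asserted in the theorem into invariance of f - f|g under [h]. *)
Lemma slash_gr_1B g h z : uhp z ->
  slash_gr k f ((1 - gr_elt C g) * (1 - gr_elt C h)) z =
  (f z - slash k f g z) - slash k (fun z => f z - slash k f g z) h z.
Proof.
move=> z0.
have -> : (1 - gr_elt C g) * (1 - gr_elt C h) =
    (gr_elt C 1%g - gr_elt C h) - (gr_elt C g - gr_elt C (g * h)%g).
  by rewrite mulrBl mul1r mulrBr mulr1 gr_eltM.
have grB4 A B E D : slash_gr k f (A - B - (E - D)) z = slash_gr k f A z -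
    slash_gr k f B z - (slash_gr k f E z - slash_gr k f D z) by rewrite !slash_grB.
rewrite grB4 !slash_gr_elt.
rewrite slash1 -(slashM _ _ _ _ z0).
have -> : slash k (fun z => f z - slash k f g z) h z =
    slash k f h z - slash k (slash k f g) h z by rewrite /slash mulrBr.
by ring.
Qed.

Lemma slash_gr_hecke13 p z : p != 13 ->
  slash_gr k f (hecke13 R p) z =
  slash k f (gl2 p%:R 0 0 1) z + \sum_(0 <= a < p) slash k f (gl2 1 a%:R 0 p%:R) z.
Proof.
move=> p13; rewrite /hecke13 p13 slash_grD slash_grZ mul1r slash_gr_elt
  slash_gr_sum; congr (_ + _).
by apply: eq_bigr => a _; rewrite slash_gr_elt.
Qed.

End GroupRingAction.

(** * The Fourier expansion and invariance under z -> z + 1 *)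

Section Periodicity.
Variable R : realType.
Local Notation C := R[i].

Lemma cexp_period (n : nat) (z : C) :
  cexp (2 * pi%:C * 'i%C * n%:R * (z + 1)) = cexp (2 * pi%:C * 'i%C * n%:R * z).
Proof.
have -> : 2 * pi%:C * 'i%C * n%:R * (z + 1) = 2 * pi%:C * 'i%C * n%:R * z + ('i%C
  * (pi *+ 2 *+ n)%:C).
  rewrite mulrDr mulr1; congr (_ + _).
  by rewrite !rmorphMn /= -mulr_natr -[_ *+ 2]mulr_natr; ring.
have cn (x : R) : cos (x + pi *+ 2 *+ n) = cos x by exact: (periodicn (@cosD2pi R)
  n x).
have sn (x : R) : sin (x + pi *+ 2 *+ n) = sin x by exact: (periodicn (@sinD2pi R)
  n x).
move: (_ * z) => w; rewrite /cexp; case: w => x y /=.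
by rewrite !(mul0r, mul1r, subr0, oppr0, addr0, add0r) cn sn.
Qed.

Lemma fourier_expansion_period (f : C -> C) (a : nat -> C) (z : C) :
  fourier_expansion f a -> uhp z -> f (z + 1) = f z.
Proof.
move=> fa z0; have z1 : uhp (z + 1) by case: z z0 => x y; rewrite /uhp /= addr0.
have := fa _ z1; under eq_fun do under eq_bigr do rewrite cexp_period.
by move=> h; apply: (cvg_unique _ h (fa _ z0)).
Qed.

End Periodicity.

(** * Relations obtained from the Hecke operators and H *)

Local Ltac mat := lazymatch goal with
  | |- is_true _ => rewrite /=;
      solve [lra | apply/eqP; lra
            | apply/and5P; split; first (apply/eqP; lra); apply/eqP; lra]
  | _ => idtac
  end.

(** The matrix is -gamma^-1 for gamma = (3 1; -13 -4); for even [k] it acts as gamma^-1. *)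
Definition gammaV_defect (R : realType) k (f : R[i] -> R[i]) (z : R[i]) : R[i] :=
  f z - slash k f (gl2 4 1 (-13) (-3)) z.

Section HeckeRelations.
Variable R : realType.
Local Notation C := R[i].
Variables (k : nat) (f : C -> C) (sigma lambda2 lambda3 : C).
Hypothesis k_even : ~~ odd k.
Local Notation "f $[ a , b ; c , d ]" := (slash k f (gl2 a b c d))
  (at level 40, a, b, c, d at level 99, left associativity).

(* The scalar [t] clears the common factors of the entries of the product matrix. *)
Lemma slash_left (h g : C -> C) (chi : C) (a b c d : R) (a' b' c' d' t A B E D :
  R) z :
  (forall z, uhp z -> (h $[a, b; c, d]) z = chi * g z) -> uhp z ->
  0 < a * d - b * c -> 0 < a' * d' - b' * c' ->
  [&& t != 0, a * a' + b * c' == t * A, a * b' + b * d' == t * B,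
      c * a' + d * c' == t * E & c * b' + d * d' == t * D] ->
  (h $[A, B; E, D]) z = chi * (g $[a', b'; c', d']) z.
Proof.
move=> hg z0 D1 D2 /and5P[t0 /eqP eA /eqP eB /eqP eE /eqP eD].
have D3 : 0 < A * D - B * E.
  have : 0 < t ^+ 2 * (A * D - B * E).
    have -> : t ^+ 2 * (A * D - B * E) = (t * A) * (t * D) - (t * B) * (t * E) by
      ring.
    rewrite -eA -eB -eE -eD.
    have -> : ((a * a' + b * c') * (c * b' + d * d') -
      (a * b' + b * d') * (c * a' + d * c')) = (a * d - b * c) * (a' * d' - b' *
        c').
      by ring.
    exact: mulr_gt0.
  by rewrite pmulr_rgt0 // lt_neqAle sqr_ge0 eq_sym expf_neq0.
rewrite -(slash_gl2Z k_even h z D3 t0) -eA -eB -eE -eD -slash_gl2M //.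
rewrite (uhp_slash _ (g := fun z => chi * g z)) //.
by rewrite /slash; ring.
Qed.

Lemma slash_left1 (h g : C -> C) (a b c d : R) (a' b' c' d' t A B E D : R) z :
  (forall z, uhp z -> (h $[a, b; c, d]) z = g z) -> uhp z ->
  0 < a * d - b * c -> 0 < a' * d' - b' * c' ->
  [&& t != 0, a * a' + b * c' == t * A, a * b' + b * d' == t * B,
      c * a' + d * c' == t * E & c * b' + d * d' == t * D] ->
  (h $[A, B; E, D]) z = (g $[a', b'; c', d']) z.
Proof.
move=> hg z0 D1 D2 e; rewrite -[RHS]mul1r.
by apply: slash_left D1 D2 e => // w w0; rewrite mul1r hg.
Qed.

Lemma slash_gl2_id (h : C -> C) z : (h $[1, 0; 0, 1]) z = h z.
Proof.
rewrite (_ : gl2 1 0 0 1 = 1%g) ?slash1 //; apply: val_inj.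
rewrite val_gl2 ?mulr1 ?mulr0 ?subr0 //.
by apply/matrixP => i j; rewrite !mxE; case: i => [[|[|//]] ?]; case: j =>
  [[|[|//]] ?].
Qed.

Lemma slash_comp (h : C -> C) (a b c d : R) (a' b' c' d' t A B E D : R) z :
  uhp z -> 0 < a * d - b * c -> 0 < a' * d' - b' * c' ->
  [&& t != 0, a * a' + b * c' == t * A, a * b' + b * d' == t * B,
      c * a' + d * c' == t * E & c * b' + d * d' == t * D] ->
  ((h $[a, b; c, d]) $[a', b'; c', d']) z = (h $[A, B; E, D]) z.
Proof. by move=> z0 D1 D2 e; rewrite (@slash_left1 h (h $[a, b; c, d]) a b c d _ _
  _ _ _ _ _ _ _ z _ z0 D1 D2 e). Qed.

Hypothesis fT : forall z, uhp z -> (f $[1, 1; 0, 1]) z = f z.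
Hypothesis fH : forall z, uhp z -> (f $[0, -1; 13, 0]) z = sigma * f z.
Hypothesis sigma2 : sigma * sigma = 1.
Hypothesis fT2 : forall z, uhp z ->
  (f $[2, 0; 0, 1]) z + (f $[1, 0; 0, 2]) z + (f $[1, 1; 0, 2]) z = lambda2 * f z.
Hypothesis fT3 : forall z, uhp z ->
  (f $[3, 0; 0, 1]) z + (f $[1, 0; 0, 3]) z + (f $[1, 1; 0, 3]) z +
  (f $[1, 2; 0, 3]) z = lambda3 * f z.

Lemma fTV z : uhp z -> (f $[1, -1; 0, 1]) z = f z.
Proof.
move=> z0; rewrite -[RHS]slash_gl2_id.
by rewrite (@slash_left1 f f 1 1 0 1 1 (-1) 0 1 1 1 0 0 1 z fT z0) //; mat.
Qed.

Lemma slashD (F G : C -> C) (M : GL2p R) z :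
  slash k (fun z => F z + G z) M z = slash k F M z + slash k G M z.
Proof. by rewrite /slash; ring. Qed.

Lemma slashZ (c : C) (F : C -> C) (M : GL2p R) z :
  slash k (fun z => c * F z) M z = c * slash k F M z.
Proof. by rewrite /slash; ring. Qed.

Lemma slashB (F G : C -> C) (M : GL2p R) z :
  slash k (fun z => F z - G z) M z = slash k F M z - slash k G M z.
Proof. by rewrite /slash; ring. Qed.

(** With T = (1 1; 0 1), H T^-1 H = -13 (1 0; 13 1), and the two signs picked up from H cancel by
    [sigma2]. *)
Lemma fW z : uhp z -> (f $[1, 0; 13, 1]) z = f z.
Proof.
move=> z0.
have fHT w : uhp w -> (f $[0, -1; 13, -13]) w = sigma * f w.
  move=> w0; rewrite (@slash_left f f sigma 0 (-1) 13 0 1 (-1) 0 1 1 0 (-1) 13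
    (-13) w fH w0); mat.
  by rewrite fTV.
rewrite (@slash_left f f sigma 0 (-1) 13 (-13) 0 (-1) 13 0 (-13) 1 0 13 1 z fHT
  z0); mat.
by rewrite fH // (mulrA sigma) sigma2 mul1r.
Qed.

Lemma fWV z : uhp z -> (f $[1, 0; -13, 1]) z = f z.
Proof.
move=> z0; rewrite -[RHS]slash_gl2_id.
by rewrite (@slash_left1 f f 1 0 13 1 1 0 (-13) 1 1 1 0 0 1 z fW z0) //; mat.
Qed.

(** (a b; 0 d) H = H (d 0; -13b a): conjugation by H exchanges upper triangular Hecke
    representatives with lower triangular ones. *)
Lemma slash_tri_H (a b d b' : R) z : uhp z -> 0 < a * d -> b' == - 13 * b ->
  ((f $[a, b; 0, d]) $[0, -1; 13, 0]) z = sigma * (f $[d, 0; b', a]) z.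
Proof.
move=> z0 ad /eqP ->.
rewrite (@slash_comp f a b 0 d 0 (-1) 13 0 1 (13 * b) (- a) (13 * d) 0 z z0); mat.
by rewrite (@slash_left f f sigma 0 (-1) 13 0 d 0 (-13 * b) a 1 _ _ _ _ z fH z0);
  mat.
Qed.

(** As f|H is a multiple of f, the [T_2] relation also holds for the representatives conjugated by
    H. The two diagonal ones are exchanged and cancel, which leaves one term on each side. *)
Lemma T2_fricke z : uhp z -> (f $[2, 0; -13, 1]) z = (f $[1, 1; 0, 2]) z.
Proof.
move=> z0.
have := uhp_slash k (gl2 0 (-1) 13 0) fT2 z0.
rewrite !slashD slashZ.
rewrite fH // (@slash_tri_H 2 0 1 0) ?(@slash_tri_H 1 0 2 0) ?(@slash_tri_H 1 1 2
  (-13)) //; mat.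
rewrite (mulrCA lambda2 sigma) -fT2 // -!mulrDr => /(congr1 (fun x => sigma * x)).
rewrite !(mulrA sigma sigma) sigma2 !mul1r => h.
have -> : (f $[ 2, 0; -13, 1]) z = ((f $[ 1, 0; 0, 2]) z + (f $[ 2, 0; 0, 1]) z +
     (f $[ 2, 0; -13, 1]) z) - ((f $[ 1, 0; 0, 2]) z + (f $[ 2, 0; 0, 1]) z) by
       ring.
by rewrite h; ring.
Qed.

(** As for [T_2], but two terms remain on each side; [fT] and [fW] move (1 2; 0 3) and (3 0; -26 1)
    to the representatives with entry -1 and 13. *)
Lemma T3_fricke z : uhp z -> (f $[3, 0; -13, 1]) z + (f $[3, 0; 13, 1]) z =
  (f $[1, 1; 0, 3]) z + (f $[1, -1; 0, 3]) z.
Proof.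
move=> z0.
have := uhp_slash k (gl2 0 (-1) 13 0) fT3 z0.
rewrite !slashD slashZ.
rewrite fH // (@slash_tri_H 3 0 1 0) ?(@slash_tri_H 1 0 3 0) ?(@slash_tri_H 1 1 3
  (-13)) ?(@slash_tri_H 1 2 3 (-26)) //; mat.
rewrite (mulrCA lambda3 sigma) -fT3 // -!mulrDr => /(congr1 (fun x => sigma * x)).
rewrite !(mulrA sigma sigma) sigma2 !mul1r.
rewrite (@slash_left1 f f 1 1 0 1 1 (-1) 0 3 1 1 2 0 3 z fT z0); mat.
rewrite -(@slash_left1 f f 1 0 13 1 3 0 (-26) 1 1 3 0 13 1 z fW z0); mat.
move=> h.
have -> : (f $[ 3, 0; -13, 1]) z + (f $[ 3, 0; 13, 1]) z = ((f $[ 1, 0; 0, 3]) z +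
  (f $[ 3, 0; 0, 1]) z +
     (f $[ 3, 0; -13, 1]) z + (f $[ 3, 0; 13, 1]) z) - ((f $[ 1, 0; 0, 3]) z + (f
       $[ 3, 0; 0, 1]) z) by ring.
by rewrite h; ring.
Qed.

(** Applying the [T_2] relation and then either of the two matrices identified by [T2_fricke] gives
    the same function. Among the products, multiples of (1 1; 0 1) and (1 0; -13 1) fix f and
    cancel; the others are the terms below, up to [fT] and [fW]. *)
Lemma T4_fricke z : uhp z -> (f $[4, 0; -13, 1]) z + (f $[4, 0; 13, 1]) z =
  (f $[1, 1; 0, 4]) z + (f $[1, -1; 0, 4]) z.
Proof.
move=> z0.
have T2M M : slash k (f $[2, 0; 0, 1]) M z + slash k (f $[1, 0; 0, 2]) M z + slash
  k (f $[1, 1; 0, 2]) M z = lambda2 * slash k f M z.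
  by have := uhp_slash k M fT2 z0; rewrite !slashD slashZ.
have := T2M (gl2 1 1 0 2); rewrite -T2_fricke // -T2M.
(* Reading [T2_fricke] backwards makes the third product the square of a lower triangular matrix. *)
rewrite (uhp_slash k (gl2 2 0 (-13) 1) (fun w w0 => esym (T2_fricke w0)) z0).
rewrite (@slash_comp f 2 0 0 1 1 1 0 2 2 1 1 0 1 z z0); mat.
rewrite (@slash_comp f 1 0 0 2 1 1 0 2 1 1 1 0 4 z z0); mat.
rewrite (@slash_comp f 1 1 0 2 1 1 0 2 1 1 3 0 4 z z0); mat.
rewrite (@slash_comp f 2 0 0 1 2 0 (-13) 1 1 4 0 (-13) 1 z z0); mat.
rewrite (@slash_comp f 1 0 0 2 2 0 (-13) 1 2 1 0 (-13) 1 z z0); mat.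
rewrite (@slash_comp f 2 0 (-13) 1 2 0 (-13) 1 1 4 0 (-39) 1 z z0); mat.
rewrite fT // fWV //.
rewrite (@slash_left1 f f 1 1 0 1 1 (-1) 0 4 1 1 3 0 4 z fT z0); mat.
rewrite -(@slash_left1 f f 1 0 13 1 4 0 (-39) 1 1 4 0 13 1 z fW z0); mat.
move=> h.
have -> : (f $[ 1, 1; 0, 4]) z + (f $[ 1, -1; 0, 4]) z = (f z + (f $[ 1, 1; 0, 4])
  z + (f $[ 1, -1; 0, 4]) z) - f z by ring.
by rewrite h; ring.
Qed.

(** Up to a scalar, delta = (2 0; -13 1)(1 1; 0 2)^-1 is the quotient of the two matrices in
    [T2_fricke]. *)
Lemma f_delta z : uhp z -> (f $[2, -1; -13, 7]) z = f z.
Proof.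
move=> z0.
rewrite (@slash_left1 f (f $[1, 1; 0, 2]) 2 0 (-13) 1 2 (-1) 0 1 2 2 (-1) (-13) 7
  z T2_fricke z0); mat.
rewrite (@slash_comp f 1 1 0 2 2 (-1) 0 1 2 1 0 0 1 z z0); mat.
exact: slash_gl2_id.
Qed.

Lemma f_e2 z : uhp z -> (f $[-5, -1; 26, 5]) z = (f $[4, 1; -13, -3]) z.
Proof.
move=> z0.
have fdT w : uhp w -> (f $[2, 1; -13, -6]) w = f w.
  move=> w0; rewrite (@slash_left1 f f 2 (-1) (-13) 7 1 1 0 1 1 2 1 (-13) (-6) w
    f_delta w0); mat.
  exact: fT.
by rewrite (@slash_left1 f f 2 1 (-13) (-6) 4 1 (-13) (-3) 1 (-5) (-1) 26 5 z fdT
  z0); mat.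
Qed.

Local Notation u := (gammaV_defect k f).

Lemma defect_slash (A B E D : R) (a b c d : R) (t : R) z : uhp z ->
  0 < A * D - B * E ->
  [&& t != 0, 4 * A + 1 * E == t * a, 4 * B + 1 * D == t * b,
      -13 * A + -3 * E == t * c & -13 * B + -3 * D == t * d] ->
  (u $[A, B; E, D]) z = (f $[A, B; E, D]) z - (f $[a, b; c, d]) z.
Proof.
move=> z0 D0 e; rewrite slashB; congr (_ - _).
by rewrite (@slash_comp f 4 1 (-13) (-3) A B E D t a b c d z z0) //; mat.
Qed.

Lemma u_e2 z : uhp z -> (u $[-5, -1; 26, 5]) z = - u z.
Proof.
move=> z0; rewrite slashB f_e2 //.
(* Here f|gamma^-1 is written as f|e2 again; e2 has trace 0 and determinant 1, so e2^2 = -1 and f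
   comes back. *)
rewrite (uhp_slash k (gl2 (-5) (-1) 26 5) (fun w w0 => esym (f_e2 w0)) z0).
rewrite (@slash_comp f (-5) (-1) 26 5 (-5) (-1) 26 5 (-1) 1 0 0 1 z z0); mat.
by rewrite slash_gl2_id /gammaV_defect opprB.
Qed.

(** Under gamma^-1 and H the four terms of [T4_fricke] pair off into two translates of u, by (13 1;
    -52 0) and (1 -1; 0 4). Their quotient is theta, up to a scalar. *)
Lemma u_theta z : uhp z -> (u $[26, 7; -104, -26]) z = sigma * u z.
Proof.
move=> z0.
have h w : uhp w -> (u $[13, 1; -52, 0]) w = sigma * (u $[1, -1; 0, 4]) w.
  move=> w0.
  rewrite (@defect_slash 13 1 (-52) 0 0 4 (-13) (-13) 1 w w0); mat.
  rewrite (@defect_slash 1 (-1) 0 4 4 0 (-13) 1 1 w w0); mat.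
  rewrite (@slash_left f f sigma 0 (-1) 13 0 4 0 13 1 (-1) 13 1 (-52) 0 w fH w0);
    mat.
  rewrite (@slash_left f f sigma 0 (-1) 13 0 1 1 0 4 (-1) 0 4 (-13) (-13) w fH
    w0); mat.
  rewrite -mulrBr; congr (_ * _).
  have -> : (f $[4, 0; 13, 1]) w = ((f $[4, 0; -13, 1]) w + (f $[4, 0; 13, 1]) w)
    - (f $[4, 0; -13, 1]) w by ring.
  by rewrite T4_fricke //; ring.
rewrite (@slash_left u (u $[1, -1; 0, 4]) sigma 13 1 (-52) 0 4 1 0 1 2 26 7 (-104)
  (-26) z h z0); mat.
by rewrite (@slash_comp u 1 (-1) 0 4 4 1 0 1 4 1 0 0 1 z z0) ?slash_gl2_id //; mat.
Qed.

(** The same pairing for [T3_fricke]; here the quotient of the two translating matrices is eta, up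
    to a scalar. *)
Lemma u_eta z : uhp z -> (u $[-39, -9; 182, 39]) z = sigma * u z.
Proof.
move=> z0.
have h w : uhp w -> (u $[0, -3; 13, 13]) w = sigma * (u $[3, 0; -13, 1]) w.
  move=> w0.
  rewrite (@defect_slash 0 (-3) 13 13 13 1 (-39) 0 1 w w0); mat.
  rewrite (@defect_slash 3 0 (-13) 1 1 (-1) 0 3 (-1) w w0); mat.
  rewrite (@slash_left f f sigma 0 (-1) 13 0 3 0 13 1 (-1) 13 1 (-39) 0 w fH w0);
    mat.
  rewrite (@slash_left f f sigma 0 (-1) 13 0 1 1 0 3 1 0 (-3) 13 13 w fH w0); mat.
  rewrite -mulrBr; congr (_ * _).
  have -> : (f $[3, 0; 13, 1]) w = ((f $[3, 0; -13, 1]) w + (f $[3, 0; 13, 1]) w)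
    - (f $[3, 0; -13, 1]) w by ring.
  by rewrite T3_fricke //; ring.
rewrite (@slash_left u (u $[3, 0; -13, 1]) sigma 0 (-3) 13 13 1 0 13 3 1 (-39)
  (-9) 182 39 z h z0); mat.
by rewrite (@slash_comp u 3 0 (-13) 1 1 0 13 3 3 1 0 0 1 z z0) ?slash_gl2_id //;
  mat.
Qed.

(** The terms are f - f|gamma^-1, f|gamma - f and, because gamma^-2 = gamma, f|gamma^-1 - f|gamma;
    the sum telescopes. *)
Lemma u_gamma_sum z : uhp z ->
  u z + (u $[3, 1; -13, -4]) z + (u $[4, 1; -13, -3]) z = 0.
Proof.
move=> z0.
rewrite (@defect_slash 3 1 (-13) (-4) 1 0 0 1 (-1) z z0); mat.
rewrite (@defect_slash 4 1 (-13) (-3) 3 1 (-13) (-4) 1 z z0); mat.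
by rewrite slash_gl2_id /gammaV_defect; ring.
Qed.

(** The integral matrix E is 3 sqrt 13 times eps1, and gamma E = -eta gamma. The function u|gamma is
    f|(1 - gamma) up to sign. *)
Lemma u_eps1 z : uhp z ->
  ((u $[3, 1; -13, -4]) $[39, 14; -117, -39]) z = sigma * (u $[3, 1; -13, -4]) z.
Proof.
move=> z0.
rewrite (@slash_comp u 3 1 (-13) (-4) 39 14 (-117) (-39) 1 0 3 (-39) (-26) z z0);
  mat.
by rewrite (@slash_left u u sigma (-39) (-9) 182 39 3 1 (-13) (-4) (-1) 0 3 (-39)
  (-26) z u_eta z0); mat.
Qed.

(** Likewise E is 2 sqrt 13 times eps2, and gamma E = -theta gamma. *)
Lemma u_eps2 z : uhp z ->
  ((u $[3, 1; -13, -4]) $[-26, -8; 91, 26]) z = sigma * (u $[3, 1; -13, -4]) z.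
Proof.
move=> z0.
rewrite (@slash_comp u 3 1 (-13) (-4) (-26) (-8) 91 26 1 13 2 (-26) 0 z z0); mat.
by rewrite (@slash_left u u sigma 26 7 (-104) (-26) 3 1 (-13) (-4) (-1) 13 2 (-26)
  0 z u_theta z0); mat.
Qed.

(** The signs of eta and theta cancel for either sigma. The eigenvalues of this matrix are 7 + sqrt
    13 and 7 - sqrt 13, with quotient (31 + 7 sqrt 13) / 18. *)
Lemma u_eta_theta z : uhp z -> (u $[-6, -3; 52, 20]) z = u z.
Proof.
move=> z0.
rewrite (@slash_left u u sigma (-39) (-9) 182 39 26 7 (-104) (-26) 13 (-6) (-3) 52
  20 z u_eta z0); mat.
by rewrite u_theta // (mulrA sigma) sigma2 mul1r.
Qed.

(** The factor e2 contributes -1 and theta contributes sigma, so u is fixed when sigma = -1. The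
    eigenvalues are 13 + 3 sqrt 13 and 13 - 3 sqrt 13, with quotient (11 + 3 sqrt 13) / 2. *)
Lemma u_e2_theta z : uhp z -> (u $[-26, -9; 156, 52]) z = - sigma * u z.
Proof.
move=> z0.
have h w : uhp w -> (u $[-5, -1; 26, 5]) w = -1 * u w by move=> w0; rewrite u_e2
  // mulN1r.
rewrite (@slash_left u u (-1) (-5) (-1) 26 5 26 7 (-104) (-26) 1 (-26) (-9) 156 52
  z h z0); mat.
by rewrite u_theta // mulN1r mulNr.
Qed.

Lemma u_gamma z : uhp z -> (u $[3, 1; -13, -4]) z = (f $[3, 1; -13, -4]) z - f z.
Proof.
move=> z0; rewrite (@defect_slash 3 1 (-13) (-4) 1 0 0 1 (-1) z z0); mat.
by rewrite slash_gl2_id.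
Qed.

End HeckeRelations.

(** * Nondiscrete groups of multipliers and arithmetic of sqrt 13 *)

Section DenseMultipliers.
Variable R : realType.

(** A multiplicative group of positive reals with a gap above 1 consists of the powers of its least
    element above 1. Then [x] and [y] would be powers of one number, against their independence. *)
Lemma nondiscrete_multipliers (P : R -> Prop) (x y : R) :
  (forall s t, 0 < s -> 0 < t -> P s -> P t -> P (s / t)) ->
  1 < x -> 1 < y -> P x -> P y ->
  (forall i j, (0 < j)%N -> x ^+ i <> y ^+ j) ->
  forall e, 0 < e -> exists t, [/\ 1 < t, t < 1 + e & P t].
Proof.
move=> Pdiv x1 y1 Px Py xy e e0; apply: contrapT => none.
have gap t : 1 < t -> P t -> 1 + e <= t.
  by move=> t1 Pt; rewrite leNgt; apply/negP => te; apply: none; exists t.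
pose A := [set t : R | 1 < t /\ P t].
have infA : has_inf A by split; [exists x | exists 1 => t [t1 _]; exact: ltW].
have s1 : 1 + e <= inf A.
  by apply: lb_le_inf; [exists x | move=> t [t1 Pt]; exact: gap].
set s := inf A in s1.
have s_gt1 : 1 < s by apply: lt_le_trans s1; rewrite ltrDl.
have s0 : 0 < s by apply: lt_trans s_gt1.
have sle t : 1 < t -> P t -> s <= t by move=> t1 Pt; apply: ge_inf => //; case:
  infA.
have [r [r1 Pr] rs] := @inf_adherent _ A (s * e) (mulr_gt0 s0 e0) infA.
(* The infimum is attained: otherwise there are t < r satisfying [P] in [s, s(1 + e)), and r/t falls
   into the gap. *)
have Ps : P s.
  have := sle _ r1 Pr; rewrite le_eqVlt => /orP[/eqP -> //|sr].
  have sr0 : 0 < r - s by rewrite subr_gt0.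
  have [t [t1 Pt] ts] := inf_adherent sr0 infA.
  have tr : t < r by move: ts; rewrite -/s addrC subrK.
  have t0 : 0 < t by apply: lt_trans t1.
  have : 1 + e <= r / t.
    apply: gap; first by rewrite ltr_pdivlMr // mul1r.
    by apply: Pdiv => //; apply: lt_trans r1.
  rewrite ler_pdivlMr // => h.
  have : s * (1 + e) <= r.
    by apply: le_trans h; rewrite mulrC ler_pM2l ?sle //; apply: addr_gt0.
  by rewrite mulrDr mulr1 leNgt rs.
have P1 : P 1 by rewrite -(divff (lt0r_neq0 s0)); apply: Pdiv.
have PV t : 0 < t -> P t -> P t^-1 by move=> t0 Pt; rewrite -div1r; apply: Pdiv.
have Psn n : P (s ^+ n).
  elim: n => [|n IHn]; first by rewrite expr0.
  rewrite exprSr -[s in _ * s]invrK; apply: Pdiv => //; rewrite ?exprn_gt0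
    ?invr_gt0 //.
  exact: PV.
have pow t : 1 < t -> P t -> exists2 n, (0 < n)%N & t = s ^+ n.
  move=> t1 Pt; have t0 : 0 < t by apply: lt_trans t1.
  (* Bernoulli's inequality s^n >= 1 + (s - 1)n makes the powers of [s] unbounded. *)
  have ex : exists n, t < s ^+ n.
    have [n hn] : exists n : nat, (t - 1) / (s - 1) < n%:R.
      by exists (Num.bound ((t - 1) / (s - 1))); apply: archi_boundP;
        rewrite divr_ge0 ?subr_ge0 ?ltW.
    exists n; apply: lt_le_trans (_ : 1 + (s - 1) * n%:R <= _).
      by rewrite -ltrBlDl mulrC -ltr_pdivrMr ?subr_gt0.
    elim: n {hn} => [|n IHn]; first by rewrite mulr0 addr0 expr0.
    rewrite exprS; apply: le_trans (_ : s * (1 + (s - 1) * n%:R) <= _); last by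
      rewrite ler_pM2l.
    rewrite -natr1 -subr_ge0.
    have -> : s * (1 + (s - 1) * n%:R) - (1 + (s - 1) * (n%:R + 1)) = (s - 1) ^+ 2
      * n%:R by ring.
    by rewrite mulr_ge0 ?sqr_ge0.
  (* With n + 1 the least exponent such that t < s^(n+1), the quotient t/s^n lies in [1, s), and
     minimality of [s] forces it to be 1. *)
  case: (ex_minnP ex) => -[|n] tn nmin; first by move: tn; rewrite expr0 ltNge ltW.
  have sn : s ^+ n <= t by rewrite leNgt; apply/negP => /nmin; rewrite ltnn.
  have sn0 : 0 < s ^+ n by rewrite exprn_gt0.
  have tsn : t = s ^+ n.
    apply/eqP; rewrite eq_le sn andbT leNgt; apply/negP => snt.
    have : s <= t / s ^+ n by apply: sle; [rewrite ltr_pdivlMr ?mul1r | apply: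
      Pdiv].
    by rewrite ler_pdivlMr // -exprS leNgt tn.
  by exists n => //; rewrite lt0n; apply: contraTneq t1 => n0; rewrite tsn n0
    expr0 ltxx.
have [i i0 xi] := pow _ x1 Px; have [j j0 yj] := pow _ y1 Py.
by apply: (xy j i i0); rewrite xi yj -!exprM mulnC.
Qed.

(** If [y] were nonzero, the 13-adic valuations in x^2 = 13 y^2 would have different parity. *)
Lemma sqrt13_irrational (x y : int) :
  x%:~R + y%:~R * Num.sqrt 13 = 0 :> R -> y = 0.
Proof.
move=> h; apply/eqP; apply: contrapT => /negP y0.
have h2 : x%:~R ^+ 2 = 13 * y%:~R ^+ 2 :> R.
  have -> : x%:~R = - (y%:~R * Num.sqrt 13) :> R by rewrite -[LHS]addr0 -[X in _ +
    X](subrr (y%:~R * Num.sqrt 13 : R)) addrA h add0r.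
  by rewrite sqrrN exprMn sqr_sqrtr // mulrC.
have h3 : (`|x| ^ 2 = 13 * `|y| ^ 2)%N.
  have : x ^+ 2 = 13 * y ^+ 2.
    by apply: (intr_inj (R := R)); rewrite rmorphXn [RHS]rmorphM /= rmorphXn /= h2.
  by move=> /(congr1 absz); rewrite abszM !abszX.
have yp : (0 < `|y|)%N by rewrite absz_gt0.
have := congr1 (logn 13) h3.
by rewrite lognM ?expn_gt0 ?yp // !lognX (_ : logn 13 13 = 1)%N //; lia.
Qed.

(* [a + b sqrt 13 -> a + b mod 3] is a ring morphism; it kills
   [18] but not [31 + 7 s]. *)
Lemma sqrt13_pow (p q : int) n : exists a b : int,
  (p%:~R + q%:~R * Num.sqrt 13) ^+ n = a%:~R + b%:~R * Num.sqrt 13 :> R /\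
  ((a + b)%R = (p + q) ^+ n %[mod 3])%Z.
Proof.
have s2 : Num.sqrt 13 * Num.sqrt 13 = 13 :> R by rewrite -expr2 sqr_sqrtr.
elim: n => [|n [a [b [e m]]]]; first by exists 1, 0; rewrite !expr0 mul0r addr0.
exists (p * a + 13 * q * b), (p * b + q * a); split.
  rewrite exprS e !(rmorphD, rmorphM) /=.
  have -> : (p%:~R + q%:~R * Num.sqrt 13) * (a%:~R + b%:~R * Num.sqrt 13) =
    p%:~R * a%:~R + q%:~R * b%:~R * (Num.sqrt 13 * Num.sqrt 13) + (p%:~R * b%:~R +
      q%:~R * a%:~R) * Num.sqrt 13 :> R by ring.
  by rewrite s2; ring.
rewrite exprS -modzMmr -m modzMmr.
have -> : p * a + 13 * q * b + (p * b + q * a) = (4 * q * b) * 3 + (p + q) * (a +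
  b) by ring.
by rewrite modzMDl.
Qed.

(** Denominators are cleared and coordinate sums are taken modulo 3: the left side vanishes since 3
    divides 18 and j > 0, while the right side is 2^i 38^j, prime to 3. *)
Lemma multipliers_independent i j : (0 < j)%N ->
  ((11 + 3 * Num.sqrt 13) / 2) ^+ i <> ((31 + 7 * Num.sqrt 13) / 18) ^+ j :> R.
Proof.
move=> j0; rewrite !exprMn !exprVn => h.
have {}h : 18 ^+ j * (11 + 3 * Num.sqrt 13) ^+ i = 2 ^+ i * (31 + 7 * Num.sqrt 13)
  ^+ j :> R.
  have n1 : 18 ^+ j != 0 :> R by rewrite expf_neq0 // pnatr_eq0.
  have n2 : 2 ^+ i != 0 :> R by rewrite expf_neq0 // pnatr_eq0.
  by move/eqP: h; rewrite eqr_div // => /eqP h; rewrite mulrC h mulrC.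
have [a [b [e1 m1]]] := sqrt13_pow 11 3 i.
have [c [d [e2 m2]]] := sqrt13_pow 31 7 j.
have := h; rewrite [(11 + _) ^+ i]e1 [(31 + _) ^+ j]e2 => h'.
have z1 : (18 ^+ j * a - 2 ^+ i * c)%:~R + (18 ^+ j * b - 2 ^+ i * d)%:~R *
  Num.sqrt 13 = 0 :> R.
  rewrite !(rmorphB, rmorphM, rmorphXn) /=.
  have -> (X Y A B E D S : R) : X * A - Y * E + (X * B - Y * D) * S = X * (A + B *
    S) - Y * (E + D * S) by ring.
  by rewrite h' subrr.
have b0 := sqrt13_irrational z1.
have a0 : 18 ^+ j * a - 2 ^+ i * c = 0.
  by move: z1; rewrite b0 mul0r addr0 => /eqP; rewrite intr_eq0 => /eqP.
have : 18 ^+ j * (a + b) = 2 ^+ i * (c + d).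
  by rewrite !mulrDr; move: a0 b0 => /subr0_eq -> /subr0_eq ->.
move=> e3; have : (3 %| 2 ^+ i * (c + d))%Z.
  by rewrite -e3 dvdz_mulr // -(prednK j0) exprS dvdz_mulr.
rewrite dvdzE abszM abszX Euclid_dvdM // Euclid_dvdX // => /orP[/andP[]//|].
rewrite -[3%N]/(absz 3) -dvdzE => /dvdz_mod0P; rewrite m2 => /dvdz_mod0P.
by rewrite dvdzE abszX Euclid_dvdX // => /andP[].
Qed.

End DenseMultipliers.

(** * Holomorphic functions and vanishing derivatives *)

Section Holomorphy.
Variable R : realType.
Local Notation C := R[i].

Lemma holomorphicB (U : set C) (g h : C -> C) :
  holomorphic_on U g -> holomorphic_on U h -> holomorphic_on U (fun z => g z - h z).
Proof. by move=> hg hh z Uz; apply: derivableB; [exact: hg | exact: hh]. Qed.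

Lemma holomorphicM (U : set C) (g h : C -> C) :
  holomorphic_on U g -> holomorphic_on U h -> holomorphic_on U (fun z => g z * h z).
Proof. by move=> hg hh z Uz; apply: derivableM; [exact: hg | exact: hh]. Qed.

Lemma holomorphic_cst (U : set C) (c : C) : holomorphic_on U (fun=> c).
Proof. by move=> z Uz; exact: derivable_cst. Qed.

Lemma holomorphic_id (U : set C) : holomorphic_on U (fun z => z).
Proof. by move=> z Uz; exact: derivable_id. Qed.

Lemma holomorphicX (U : set C) (g : C -> C) n :
  holomorphic_on U g -> holomorphic_on U (fun z => g z ^+ n).
Proof.
move=> hg; elim: n => [|n IHn]; first exact: holomorphic_cst.
by under eq_fun do rewrite exprS; apply: holomorphicM.
Qed.

Lemma holomorphicV (U : set C) (g : C -> C) :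
  (forall z, U z -> g z != 0) -> holomorphic_on U g ->
  holomorphic_on U (fun z => (g z)^-1).
Proof. by move=> g0 hg z Uz; apply: derivableV; [exact: g0 | exact: hg]. Qed.

Lemma holomorphicD (U : set C) (g h : C -> C) :
  holomorphic_on U g -> holomorphic_on U h -> holomorphic_on U (fun z => g z + h z).
Proof. by move=> hg hh z Uz; apply: derivableD; [exact: hg | exact: hh]. Qed.

Lemma holomorphic_comp (U V : set C) (g h : C -> C) :
  holomorphic_on U g -> holomorphic_on V h -> (forall z, U z -> V (g z)) ->
  holomorphic_on U (fun z => h (g z)).
Proof.
move=> hg hh UV z Uz; apply/derivable1_diffP.
apply: (@differentiable_comp _ _ _ _ (g : C^o -> C^o) (h : C^o -> C^o)).
  by apply/derivable1_diffP; exact: hg.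
by apply/derivable1_diffP; apply/hh/UV.
Qed.

Lemma holomorphic_slash k (h : C -> C) (M : GL2p R) :
  holomorphic_on (@uhp R) h -> holomorphic_on (@uhp R) (slash k h M).
Proof.
move=> hh; case: (GL2pP M) => a [b [c [d [D0 eM]]]].
rewrite (_ : slash k h M = fun z => (a * d - b * c)%:C ^+ k./2 *
  ((c%:C * z + d%:C) ^+ k)^-1 * h ((a%:C * z + b%:C) / (c%:C * z + d%:C))).
  have aff p q : holomorphic_on (@uhp R) (fun z => p * z + q).
    apply: holomorphicD; last exact: holomorphic_cst.
    by apply: holomorphicM; [exact: holomorphic_cst | exact: holomorphic_id].
  have denX : holomorphic_on (@uhp R) (fun z => ((c%:C * z + d%:C) ^+ k)^-1).
    apply: (@holomorphicV _ (fun z => (c%:C * z + d%:C) ^+ k)).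
      by move=> z z0; rewrite expf_neq0 // (mobius_den_neq0 D0).
    exact (holomorphicX (n := k) (aff c%:C d%:C)).
  have mob : holomorphic_on (@uhp R) (fun z => (a%:C * z + b%:C) / (c%:C * z +
    d%:C)).
    refine (holomorphicM (aff _ _) (holomorphicV _ (aff _ _))) => z.
    exact: (mobius_den_neq0 D0).
  apply: holomorphicM; first exact (holomorphicM (@holomorphic_cst _ _) denX).
  by apply: (holomorphic_comp mob hh) => z; exact: mobius_uhp.
by apply/funext => z; rewrite (slash_mx2 _ _ _ eM).
Qed.


(** Difference quotients vanish along the increments that preserve the value of [w], and these are
    arbitrarily small; hence the derivative is 0, which is recorded as an epsilon-delta estimate. *)
Lemma derivable_flat (w : C -> C) (z : C) :
  derivable (w : C^o -> C^o) (z : C^o) (1 : C^o) ->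
  (forall e : R, 0 < e -> exists h : C, [/\ h != 0, `|h| < e%:C & w (z + h) = w
    z]) ->
  forall e : R, 0 < e -> exists2 d : R, 0 < d &
    forall h : C, `|h| < d%:C -> `|w (z + h) - w z| <= e%:C * `|h|.
Proof.
move=> /cvg_ex[/= l wl] flat.
have near (e : R) : 0 < e -> exists2 d : R, 0 < d & forall h : C, h != 0 -> `|h| <
  d%:C ->
    `|l - h^-1 * (w (z + h) - w z)| < e%:C.
  move=> e0; have e0' : 0 < e%:C :> C by rewrite ltcR.
  have /cvgrPdist_lt/(_ _ e0') := wl.
  case => /= d d0 hd; exists (complex.Re d).
    by move: d0; rewrite ltcE => /andP[].
  move=> h h0 hhd; have := hd h; rewrite /= sub0r normrN.
  have dE : d = (complex.Re d)%:C by rewrite RRe_real // gtr0_real.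
  by rewrite dE => /(_ hhd h0); rewrite [h%:A]mulr1 (addrC z).
have l0 : l = 0.
  apply/eqP; rewrite -normr_eq0; apply: contrapT => /negP l0.
  have lR : `|l| = (complex.Re `|l|)%:C by rewrite RRe_real // normr_real.
  have Rl0 : 0 < complex.Re `|l|.
    have : 0 < `|l| by rewrite lt_neqAle eq_sym l0 normr_ge0.
    by rewrite ltcE => /andP[].
  have [d d0 hd] := near _ Rl0; have [h [h0 hh wh]] := flat _ d0.
  by have := hd h h0 hh; rewrite wh subrr mulr0 subr0 -lR ltxx.
move=> e e0; have [d d0 hd] := near _ e0; exists d => // h hh.
have [->|h0] := eqVneq h 0; first by rewrite addr0 subrr normr0 mulr0.
have := hd h h0 hh; rewrite l0 sub0r normrN normrM normfV mulrC.
by rewrite ltr_pdivrMr ?normr_gt0 // => /ltW.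
Qed.

Lemma norm_bound (z : C) : exists2 K : R, 0 < K & `|z| <= K%:C.
Proof.
rewrite normc_def; set r := Num.sqrt _; exists (r + 1); first by rewrite ltr_wpDl
  ?sqrtr_ge0.
by rewrite lecR lerDl.
Qed.

(** The half-plane is convex, so the real mean value theorem applies along the segment from [z0] to
    [z1]. *)
Lemma flat_cst (w : C -> C) :
  (forall z, uhp z -> forall e : R, 0 < e -> exists2 d : R, 0 < d &
    forall h : C, `|h| < d%:C -> `|w (z + h) - w z| <= e%:C * `|h|) ->
  forall z0 z1, uhp z0 -> uhp z1 -> w z0 = w z1.
Proof.
move=> flat z0 z1 u0 u1.
(* The choices c = 1 and c = -i recover the real and the imaginary part. *)
suff aux (c : C) : complex.Re (c * w z0) = complex.Re (c * w z1).
  apply/eqP; rewrite eq_complex; apply/andP; split; first by have := aux 1;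
    rewrite !mul1r => ->.
  by have := aux (-'i%C); rewrite !mulNr; case: (w z0) (w z1) => [? ?] [? ?] /=;
    lra.
pose path (t : R) : C := z0 + t%:C * (z1 - z0).
have pathU (t : R) : 0 <= t <= 1 -> uhp (path t).
  move=> /andP[t0 t1]; move: u0 u1; rewrite /uhp /path.
  case: (z0) (z1) => [x0 y0] [x1 y1] /= h0 h1; nra.
pose phi (t : R) : R := complex.Re (c * w (path t)).
have phi' (t : R) : 0 <= t <= 1 -> is_derive t (1 : R) phi (0 : R).
  move=> t01.
  have cv : h^-1 *: (phi (h *: 1 + t) - phi t) @[h --> 0^'] --> (0 : R).
    apply/cvgrPdist_le => e e0.
    have [Kc Kc0 KcR] := norm_bound c; have [L L0 LR] := norm_bound (z1 - z0).
    pose K := Kc * L; have K0 : 0 < K by apply: mulr_gt0.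
    have KR : `|c| * `|z1 - z0| <= K%:C by rewrite /K rmorphM ler_pM.
    have [d d0 hd] := flat _ (pathU _ t01) (e / K) (divr_gt0 e0 K0).
    exists (d / L) => /=; first exact: divr_gt0.
    move=> h /=; rewrite sub0r normrN => hh h0.
    have pathD : path (h *: 1 + t) = path t + h%:C * (z1 - z0).
      rewrite /path [h *: 1]mulr1 rmorphD /=; ring.
    have hN : `|h%:C| = `|h|%:C :> C.
      by rewrite normc_def /= expr0n /= addr0 sqrtr_sqr.
    have small : `|h%:C * (z1 - z0)| < d%:C.
      rewrite normrM hN; apply: le_lt_trans (_ : `|h|%:C * L%:C < _).
        by rewrite ler_wpM2l // lecR.
      by rewrite -rmorphM /= ltcR -ltr_pdivlMr.
    have := hd _ small; rewrite -pathD => hw.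
    rewrite sub0r normrN normrM normfV mulrC ler_pdivrMr ?normr_gt0 //.
    rewrite -lecR; apply: le_trans (_ : `|c * (w (path (h *: 1 + t)) - w (path
      t))| <= _).
      apply: le_trans (normc_ge_Re _); rewrite lecR /phi mulrBr.
      by case: (c * w _) => [? ?]; case: (c * w _) => [? ?] /=.
    rewrite normrM; apply: le_trans (ler_wpM2l (normr_ge0 c) hw) _.
    rewrite normrM hN mulrCA (mulrC `|h|%:C) (mulrA `|c|).
    apply: le_trans (_ : (e / K)%:C * (K%:C * `|h|%:C) <= _).
      by rewrite ler_wpM2l ?ler_wpM2r ?lecR // divr_ge0 // ltW.
    by rewrite -!rmorphM /= lecR mulrA divfK // gt_eqF.
  by apply: DeriveDef; [apply/cvg_ex; exists 0 | exact: cvg_lim].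
have cont : {within `[0 : R, 1], continuous phi}.
  by apply: derivable_within_continuous => t; rewrite in_itv /= => t01; have :=
    phi' _ t01 => -[].
have dphi (t : R) : t \in `]0, 1[%R -> is_derive t (1 : R) phi ((fun=> 0 : R) t).
  by rewrite in_itv /= => /andP[/ltW t0 /ltW t1]; apply: phi'; rewrite t0.
have [t _] := MVT ltr01 dphi cont.
rewrite mul0r /phi /path => /eqP; rewrite subr_eq0 mul1r mul0r addr0 addrC subrK
  => /eqP -> //.
Qed.
End Holomorphy.

(** * Functions invariant under two hyperbolic matrices with a common axis *)

Definition quad (R : realType) (a b c : R) (z : R[i]) : R[i] :=
  a%:C * z ^+ 2 + b%:C * z + c%:C.

Section HyperbolicInvariance.
Variable R : realType.
Local Notation C := R[i].
Variables (k : nat) (u : C -> C).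
Hypothesis k_even : ~~ odd k.
Hypothesis u_hol : holomorphic_on (@uhp R) u.
Local Notation "f $[ a , b ; c , d ]" := (slash k f (gl2 a b c d))
  (at level 40, a, b, c, d at level 99, left associativity).
Local Notation m := (k./2).
Variable s : R.
Hypothesis s_def : s = Num.sqrt 13.
Hypothesis uA : forall z, uhp z -> (u $[-26, -9; 156, 52]) z = u z.
Hypothesis uB : forall z, uhp z -> (u $[-6, -3; 52, 20]) z = u z.

Let s2 : s * s = 13. Proof. by rewrite s_def -expr2 sqr_sqrtr. Qed.
Let s3 : 3 < s. Proof. rewrite ltNge; apply/negP => h; have := s2; have :=
  sqrtr_ge0 (13 : R); rewrite -s_def; nra. Qed.
Let s4 : s < 4.
Proof. rewrite ltNge; apply/negP => h; have := s2; nra. Qed.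

(** The matrix sends infinity and 0 to -3/(13 + s) and -3/(13 - s), the roots of 52z^2 + 26z + 3, so
    in [v] the common axis becomes the imaginary one. The factor z^m in [w] absorbs the weight
    factor of a scaling. *)
Let v := u $[3, 3; -(13 + s), -(13 - s)].
Let w z := z ^+ m * v z.

Let v_scale1 z : uhp z -> (v $[(11 + 3 * s) / 2, 0; 0, 1]) z = v z.
Proof.
move=> z0.
have s2' := s2; have s3' := s3; have s4' := s4; have s23 := congr1 (fun x => x *
  s) s2.
(* The quotient of the eigenvalues of (-26 -9; 156 52); the columns of the matrix defining [v] are
   eigenvectors, the second one for 13 - 3s, which is the scalar used below. *)
set x := (11 + 3 * s) / 2.
rewrite /v (@slash_comp _ _ k_even u 3 3 (-(13 + s)) (-(13 - s)) x 0 0 1 1 (3 * x)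
  3 (-(13 + s) * x) (-(13 - s)) z z0) /x; [|by mat..].
by rewrite (@slash_left1 _ _ k_even u u (-26) (-9) 156 52 3 3 (-(13 + s)) (-(13 -
  s)) (13 - 3 * s) _ _ _ _ z uA z0) //; mat.
Qed.

Let v_scale2 z : uhp z -> (v $[(31 + 7 * s) / 18, 0; 0, 1]) z = v z.
Proof.
move=> z0.
have s2' := s2; have s3' := s3; have s4' := s4; have s23 := congr1 (fun x => x *
  s) s2.
(* The same for (-6 -3; 52 20), whose eigenvalue on the second column is 7 - s. *)
set x := (31 + 7 * s) / 18.
rewrite /v (@slash_comp _ _ k_even u 3 3 (-(13 + s)) (-(13 - s)) x 0 0 1 1 (3 * x)
  3 (-(13 + s) * x) (-(13 - s)) z z0) /x; [|by mat..].
by rewrite (@slash_left1 _ _ k_even u u (-6) (-3) 52 20 3 3 (-(13 + s)) (-(13 -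
  s)) (7 - s) _ _ _ _ z uB z0) //; mat.
Qed.

Let w_scale x z : 0 < x -> (v $[x, 0; 0, 1]) z = v z -> w (x%:C * z) = w z.
Proof.
move=> x0; rewrite (slash_mx2 _ _ _ (val_gl2 _)); last by rewrite mulr1 mulr0 subr0.
rewrite mulr1 mulr0 subr0 rmorph0 rmorph1 mul0r add0r addr0 divr1 expr1n invr1
  mulr1 /w => <-.
by rewrite exprMn; ring.
Qed.

Let uhpZ (x : R) z : 0 < x -> uhp z -> uhp (x%:C * z).
Proof. by move=> x0; case: z => a b; rewrite /uhp /= mul0r addr0 => b0; rewrite
  mulr_gt0. Qed.

Let w_cst : exists c, forall z, uhp z -> w z = c.
Proof.
have v_hol : holomorphic_on (@uhp R) v by apply: holomorphic_slash.
have w_hol : holomorphic_on (@uhp R) w.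
  exact (holomorphicM (holomorphicX (n := m) (@holomorphic_id _ _)) v_hol).
pose P (x : R) := forall z, uhp z -> w (x%:C * z) = w z.
have Pdiv x y : 0 < x -> 0 < y -> P x -> P y -> P (x / y).
  move=> x0 y0 Px Py z z0.
  have y0' : 0 < y^-1 by rewrite invr_gt0.
  have zy := uhpZ y0' z0.
  rewrite rmorphM /= -mulrA (Px _ zy) -(Py _ zy) mulrA -rmorphM /=.
  by rewrite divff ?rmorph1 ?mul1r // gt_eqF.
have x1 : 1 < (11 + 3 * s) / 2 by have := s3; lra.
have x2 : 1 < (31 + 7 * s) / 18 by have := s3; lra.
have P1 : P ((11 + 3 * s) / 2).
  by move=> z z0; apply: w_scale; [lra | exact: v_scale1].
have P2 : P ((31 + 7 * s) / 18).
  by move=> z z0; apply: w_scale; [lra | exact: v_scale2].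
have indep i j : (0 < j)%N -> ((11 + 3 * s) / 2) ^+ i <> ((31 + 7 * s) / 18) ^+ j.
  by rewrite s_def; exact: multipliers_independent.
have dense := nondiscrete_multipliers Pdiv x1 x2 P1 P2 indep.
exists (w 'i%C) => z z0; apply: (flat_cst (w := w)) => //; last by rewrite /uhp /=
  ltr01.
move=> {z0}z z0; apply: derivable_flat; first exact: w_hol.
move=> e e0; have [K K0 zK] := norm_bound z.
have [x [x_gt1 xe Px]] := dense _ (divr_gt0 e0 K0).
have x10 : 0 < x - 1 by rewrite subr_gt0.
(* This increment moves [z] to xz, where [w] has the same value; it is short because x - 1 < e/K and
   |z| <= K. *)
exists ((x - 1)%:C * z); split.
- apply: mulf_neq0; first by rewrite fmorph_eq0 gt_eqF.
  by apply/eqP => z00; move: z0; rewrite z00 /uhp /= ltxx.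
- rewrite normrM (gtr0_norm (x := (x - 1)%:C)) ?ltcR //.
  apply: le_lt_trans (_ : (x - 1)%:C * K%:C < _); first by rewrite ler_wpM2l //
    lecR ltW.
  by rewrite -rmorphM ltcR -ltr_pdivlMr // ltrBlDl.
- by rewrite rmorphB /= mulrBl mul1r addrC subrK Px.
Qed.

(** Applying the adjugate matrix, of determinant 6s, to v = c z^-m returns u. The numerator and
    denominator of its Moebius map multiply to -3 times the quadratic form, whence the constant. *)
Lemma hyperbolic_invariant_power : exists c, forall z, uhp z ->
  quad 52 26 3 z != 0 /\ u z = c / quad 52 26 3 z ^+ m.
Proof.
have [c wc] := w_cst; exists (c * (6 * s)%:C ^+ m / (-3) ^+ m) => z z0.
have s3' := s3.
have D0 : 0 < - (13 - s) * 3 - (-3) * (13 + s) by lra.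
have d0 := mobius_den_neq0 D0 z0; have z1 := mobius_uhp D0 z0.
have <- : (v $[- (13 - s), -3; 13 + s, 3]) z = u z.
  rewrite /v (@slash_comp _ _ k_even u 3 3 (-(13 + s)) (-(13 - s)) (- (13 - s))
    (-3) (13 + s) 3 (6 * s) 1 0 0 1 z z0); [|by mat..].
  exact: slash_gl2_id.
rewrite (slash_mx2 _ _ _ (val_gl2 D0)).
have := wc _ z1; rewrite /w.
move: d0 z1; set D := (13 + s)%:C * z + 3%:C; set N := _ * z + _ => d0 z1 vc.
have ND : N * D = -3 * quad 52 26 3 z.
  rewrite /N /D /quad !(rmorphN, rmorphD, rmorphB) /=.
  have -> (S A T : C) : (- (A - S) * z - T) * ((A + S) * z + T) = - ((A * A - S *
    S) * z ^+ 2 + 2 * A * T * z + T * T) by ring.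
  by rewrite -[s%:C * _]rmorphM s2 !rmorph_nat; ring.
have ND0 : N / D != 0 by apply/eqP => z00; move: z1; rewrite z00 /uhp /= ltxx.
have N0 : N != 0 by apply: contraNneq ND0 => ->; rewrite mul0r.
have q0 : quad 52 26 3 z != 0.
  apply: contraTneq (mulf_neq0 N0 d0) => q0.
  by rewrite ND q0 mulr0 eqxx.
split=> //.
have -> : v (N / D) = c / (N / D) ^+ m.
  by rewrite -vc mulrAC divff ?mul1r // expf_neq0.
have -> : - (13 - s) * 3 - -3 * (13 + s) = 6 * s by ring.
have Dk : D ^+ k = D ^+ m * D ^+ m.
  by rewrite -exprD addnn halfK (negPf k_even) subn0.
have -> : quad 52 26 3 z = N * D / -3.
  by rewrite ND mulrAC divff ?mul1r // oppr_eq0 pnatr_eq0.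
rewrite Dk !exprMn !exprVn; field.
by rewrite !expf_neq0 // oppr_eq0 pnatr_eq0.
Qed.

End HyperbolicInvariance.

(** * Vanishing by the order 3 relation *)

Section HyperbolicVanishing.
Variable R : realType.
Local Notation C := R[i].
Variables (k : nat) (u : C -> C).
Local Notation "f $[ a , b ; c , d ]" := (slash k f (gl2 a b c d))
  (at level 40, a, b, c, d at level 99, left associativity).
Local Notation m := (k./2).
Hypothesis k_even : ~~ odd k.
Hypothesis u_hol : holomorphic_on (@uhp R) u.
Hypothesis uA : forall z, uhp z -> (u $[-26, -9; 156, 52]) z = u z.
Hypothesis uB : forall z, uhp z -> (u $[-6, -3; 52, 20]) z = u z.
Hypothesis k_gt0 : (0 < k)%N.
Hypothesis u_sum : forall z, uhp z ->
  u z + (u $[3, 1; -13, -4]) z + (u $[4, 1; -13, -3]) z = 0.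

(* The test point [y] is close to the root 1/sqrt 13 of
   [q|gamma^-1 = 1 - 13 z^2], so that the corresponding term dominates. *)
Lemma hyperbolic_invariant_eq0 z : uhp z -> u z = 0.
Proof.
have [c uc] := hyperbolic_invariant_power k_even u_hol erefl uA uB.
suff c0 : c = 0 by move=> /uc[_ ->]; rewrite c0 mul0r.
(* The quadratic form transforms with weight -2, so translating c/q^m by a matrix of determinant 1
   only changes the form. *)
have slash_u (a b e d : R) (p q r : R) w' : uhp w' -> a * d - b * e = 1 ->
    (forall y, e%:C * y + d%:C != 0 -> quad 52 26 3 ((a%:C * y + b%:C) / (e%:C * y
      + d%:C)) * (e%:C * y + d%:C) ^+ 2 = quad p q r y) ->
    (u $[a, b; e, d]) w' = c / quad p q r w' ^+ m.
  move=> w0 D1 qE; have D0 : 0 < a * d - b * e by rewrite D1.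
  have d0 := mobius_den_neq0 D0 w0.
  rewrite (slash_mx2 _ _ _ (val_gl2 D0)) D1 expr1n mul1r.
  have [_ ->] := uc _ (mobius_uhp D0 w0).
  rewrite -qE // exprMn -exprM mul2n halfK (negPf k_even) subn0 invfM.
  by rewrite mulrCA; congr (_ * _); exact: mulrC.
pose y : C := 4^-1 +i* 10^-1.
have y0 : uhp y by rewrite /uhp /=; lra.
have := u_sum y0.
rewrite (@slash_u 3 1 (-13) (-4) (-39) (-26) (-4)) //; last 2 first.
- by lra.
- by move=> t; rewrite /quad !(rmorphN, rmorph_nat) => t0; field.
rewrite (@slash_u 4 1 (-13) (-3) (-13) 0 1) //; last 2 first.
- by lra.
- by move=> t; rewrite /quad !(rmorphN, rmorph0, rmorph_nat) => t0; field.
have [_ ->] := uc _ y0; rewrite -!mulrDr => /eqP; rewrite mulf_eq0 => /orP[/eqP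
  //|].
have m0 : (0 < m)%N by case: (k) k_gt0 k_even => [|[|]].
have big (t : C) : 3 <= `|complex.Re t| -> `|(t ^+ m)^-1| <= 3^-1.
  move=> t3.
  have h3 : 3 <= `|t|.
    by apply: le_trans (normc_ge_Re t); rewrite -(rmorph_nat (real_complex R)) lecR.
  rewrite normfV normrX lef_pV2 ?posrE ?exprn_gt0 //; last by apply: lt_le_trans h3.
  apply: le_trans (h3) _; rewrite -[leLHS]expr1 ler_weXn2l //.
  by apply: le_trans (h3); rewrite ler1n.
have small (t : C) : complex.Re t ^+ 2 + complex.Im t ^+ 2 <= 1 -> t != 0 -> 1 <=
  `|(t ^+ m)^-1|.
  move=> t1 t0.
  rewrite normfV normrX invf_ge1 ?exprn_gt0 ?normr_gt0 // exprn_ile1 //.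
  by rewrite normc_def lecR -[1]sqrtr1 ler_sqrt.
move=> /eqP h.
(* At [y] the form q|gamma^-1 has modulus at most 1, while q and q|gamma have real parts of size at
   least 3; a vanishing sum of inverse powers would give 1 <= 1/3 + 1/3. *)
have q2 : quad (-13) 0 1 y != 0 /\ 1 <= `|(quad (-13) 0 1 y ^+ m)^-1|.
  have q2y : quad (-13) 0 1 y = (127 / 400) +i* (- 13 / 20).
    by rewrite /quad /y expr2; apply/eqP; rewrite eq_complex /=; apply/andP;
      split; apply/eqP; lra.
  have q20 : quad (-13) 0 1 y != 0.
    by rewrite q2y eq_complex /= negb_and; apply/orP; left; apply/eqP; lra.
  by split=> //; apply: small => //; rewrite q2y /=; lra.
have b1 : `|(quad 52 26 3 y ^+ m)^-1| <= 3^-1.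
  by apply: big; rewrite /quad /y expr2 /= ger0_norm; lra.
have b2 : `|(quad (-39) (-26) (-4) y ^+ m)^-1| <= 3^-1.
  by apply: big; rewrite /quad /y expr2 /= ler0_norm; lra.
case: q2 => _; move/eqP: h; rewrite addrC addr_eq0 => /eqP ->; rewrite normrN => h.
have : (1 : C) <= 3^-1 + 3^-1.
  by apply: le_trans h (le_trans (ler_normD _ _) (lerD b1 b2)).
have -> : (3^-1 : C) = (3^-1)%:C by rewrite fmorphV rmorph_nat.
rewrite -rmorphD -[1]/(1%:C) lecR => h1.
have : (3^-1 + 3^-1 : R) < 1 by lra.
by rewrite ltNge h1.
Qed.

End HyperbolicVanishing.

(** * From the two generators to the whole group *)

Theorem mainTheorem1 (R : realType) (k : nat) (f : R[i] -> R[i])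
    (a : nat -> R[i]) :
  (0 < k)%N -> ~~ odd k ->
  holomorphic_on (@uhp R) f ->
  fourier_expansion f a ->
  ((forall z, uhp z -> slash k f (gl2 0 (-1) 13 0) z = f z) \/
   (forall z, uhp z -> slash k f (gl2 0 (-1) 13 0) z = - f z)) ->
  (forall p : nat, prime p -> forall z, uhp z ->
     slash_gr k f (hecke13 R p) z = p%:R ^ (1 - (k./2)%:Z) * a p * f z) ->
  let s : R := Num.sqrt 13 in
  let gamma : GL2p R := gl2 3 1 (-13) (-4) in
  let eps1 : GL2p R := gl2 s (14 / (3 * s)) (- (3 * s)) (- s) in
  let eps2 : GL2p R := gl2 (- s) (- 4 / s) (7 * s / 2) s in
  forall eps : GL2p R, generated [set eps1; eps2] eps ->
  forall z, uhp z ->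
    slash_gr k f ((1 - gr_elt R[i] gamma) * (1 - gr_elt R[i] eps)) z = 0.
Proof.
move=> k_gt0 k_even f_hol f_exp f_H f_hecke s gamma eps1 eps2 eps gen_eps.
have [sigma sigma_sign fH] : exists2 sigma : R[i], sigma = 1 \/ sigma = -1 &
    forall z, uhp z -> slash k f (gl2 0 (-1) 13 0) z = sigma * f z.
  by case: f_H => h; [exists 1 | exists (-1)]; [left | | right |] => // z z0;
    rewrite h // ?mul1r ?mulN1r.
have sigma2 : sigma * sigma = 1 by case: sigma_sign => ->; rewrite ?mulrNN mulr1.
have fT z : uhp z -> slash k f (gl2 1 1 0 1) z = f z.
  move=> z0; rewrite (slash_mx2 _ _ _ (val_gl2 _)); last by rewrite mulr1 mulr0 subr0.
  rewrite rmorph0 !rmorph1 mulr1 mulr0 subr0 !expr1n mul0r add0r expr1n invr1 !mul1r mulr1.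
  exact: fourier_expansion_period f_exp z0.
have sum2 (F : nat -> R[i]) : \sum_(0 <= n < 2) F n = F 0%N + F 1%N.
  by rewrite !big_nat_recr //= big_nil add0r.
have sum3 (F : nat -> R[i]) : \sum_(0 <= n < 3) F n = F 0%N + F 1%N + F 2%N.
  by rewrite !big_nat_recr //= big_nil add0r.
have fT2 z : uhp z -> slash k f (gl2 2 0 0 1) z + slash k f (gl2 1 0 0 2) z +
    slash k f (gl2 1 1 0 2) z = (2%:R ^ (1 - (k./2)%:Z) * a 2%N) * f z.
  move=> z0; rewrite -(f_hecke 2%N isT z z0) slash_gr_hecke13; last by [].
  by rewrite (sum2 (fun n => slash k f (gl2 1 n%:R 0 2%:R) z)) mulr0n mulr1n addrA.
have fT3 z : uhp z -> slash k f (gl2 3 0 0 1) z + slash k f (gl2 1 0 0 3) z +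
    slash k f (gl2 1 1 0 3) z + slash k f (gl2 1 2 0 3) z =
    (3%:R ^ (1 - (k./2)%:Z) * a 3%N) * f z.
  move=> z0; rewrite -(f_hecke 3%N isT z z0) slash_gr_hecke13; last by [].
  by rewrite (sum3 (fun n => slash k f (gl2 1 n%:R 0 3%:R) z)) mulr0n mulr1n !addrA.
pose u := gammaV_defect k f; pose h := slash k u gamma.
(* Either the sign in the relations for eps1 and eps2 is already right, or the function vanishes and
   the sign is harmless. *)
have h_cases : sigma = 1 \/ forall z, uhp z -> h z = 0.
  case: sigma_sign => [->|sigmaN]; [by left | right => z z0].
  have u_hol : holomorphic_on (@uhp R) u.
    exact (holomorphicB f_hol (holomorphic_slash f_hol)).
  have u0 w : uhp w -> u w = 0.
    apply: (hyperbolic_invariant_eq0 k_even u_hol _ _ k_gt0) => {}w w0.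
    - by rewrite (u_e2_theta k_even fT fH sigma2 fT2 w0) sigmaN opprK mul1r.
    - exact: (u_eta_theta k_even fT fH sigma2 fT2 fT3 w0).
    - exact: u_gamma_sum.
  by rewrite /h (uhp_slash k gamma (g := fun=> 0) u0 z0) /slash mulr0.
have h_eps E w : uhp w -> slash k h E w = sigma * h w -> slash k h E w = h w.
  move=> w0 ->; case: h_cases => [->|h0]; first by rewrite mul1r.
  by rewrite h0 // mulr0.
pose g z := f z - slash k f gamma z.
have gh z : uhp z -> g z = - h z by move=> z0; rewrite /g /h u_gamma // opprB.
have s0 : 0 < s by rewrite sqrtr_gt0.
have ss : s * s = 13 by rewrite -expr2 sqr_sqrtr.
clearbody s.
have sn0 : s != 0 by rewrite gt_eqF.
have sN1 : (3 * s)^-1 != 0 by rewrite invr_neq0 // mulf_neq0 // pnatr_eq0.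
have sN2 : (2 * s)^-1 != 0 by rewrite invr_neq0 // mulf_neq0 // pnatr_eq0.
have mx2Z (t p q r v : R) : t *: mx2 p q r v = mx2 (t * p) (t * q) (t * r) (t * v).
  by apply/matrixP => i j; rewrite !mxE; case: (i == 0); case: (j == 0).
have sV : s^-1 = s / 13 by rewrite -ss; field.
have eps1E : val eps1 = (3 * s)^-1 *: val (gl2 39 14 (-117) (-39) : GL2p R).
  rewrite !val_gl2 ?mx2Z; [|rewrite invfM sV; lra|lra].
  by congr mx2; rewrite invfM sV; lra.
have eps2E : val eps2 = (2 * s)^-1 *: val (gl2 (-26) (-8) 91 26 : GL2p R).
  rewrite !val_gl2 ?mx2Z; [|rewrite sV; lra|lra].
  by congr mx2; rewrite ?invfM sV; lra.
have slash_g E z : uhp z -> slash k g E z = - slash k h E z.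
  move=> z0; rewrite (uhp_slash k E gh z0) /slash; ring.
(* The matrices fixing [g] form a subgroup, so the two generators suffice. *)
have g_eps : generated [set eps1; eps2] `<=`
    [set E | forall z, uhp z -> slash k g E z = g z].
  apply: smallest_sub.
    split=> [z _|x y gx gy z z0]; first exact: slash1.
    (* After [x] is absorbed, [g] is replaced by g|y to cancel the remaining inverse of [y]. *)
    rewrite -slashM // (uhp_slash k _ gx z0) -(uhp_slash k _ gy z0) slashM //.
    by rewrite mulgV slash1.
  move=> E [->|->] z z0; rewrite slash_g // gh //; congr (- _).
    rewrite (slash_scale k_even h z sN1 eps1E).
    by apply: h_eps => //; exact: (u_eps1 k_even fT fH sigma2 fT3 z0).
  rewrite (slash_scale k_even h z sN2 eps2E).
  by apply: h_eps => //; exact: (u_eps2 k_even fT fH sigma2 fT2 z0).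
move=> z z0.
rewrite slash_gr_1B //; apply/eqP; rewrite subr_eq0; apply/eqP/esym.
exact: g_eps gen_eps z z0.
Qed.
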